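(* Let $W \subset \mathrm{GL}(V)$ be a finite complex reflection group with essential reflection arrangement $\mathcal{A}$ and braid group $B$, let $R_h : B \to \mathrm{GL}(\mathbb{C}\mathcal{A})$, $h \in \mathbb{C}$, be the family of representations defined in the context, and let $$\kappa = \kappa(W) = \min\{ n \in \mathbb{Z}_{>0} \mid \forall w \in W\ \forall H \in \mathcal{A}\ \forall \zeta \in \mathbb{C}:\ w.e_H = \zeta e_H \Rightarrow \zeta^n = 1\}.$$ Then for all $h \in \mathbb{C}$ the representation $R_{h+\kappa}$ is isomorphic to $R_h$. Moreover, $\kappa$ is the smallest positive real number such that $R_\kappa \simeq R_0$.
   Context: $V$ is a nonzero finite-dimensional $\mathbb{C}$-vector space; $W \subset \mathrm{GL}(V)$ is a finite group generated by (pseudo-)reflections (finite-order elements $s$ with $\mathrm{Ker}(s-1)$ a hyperplane); $\mathcal{A}$ is the set of hyperplanes $\mathrm{Ker}(s-1)$, $s$ a reflection of $W$, assumed essential ($\bigcap \mathcal{A} = \{0\}$). Fix a $W$-invariant hermitian scalar product on $V$; for $H \in \mathcal{A}$, $e_H$ is a nonzero vector orthogonal to $H$ and $\alpha_H \in V^*$ a linear form with kernel $H$. Let $X = V \setminus \bigcup \mathcal{A}$, on which $W$ acts freely, fix a base point $\underline{z} \in X$, and let $B = \pi_1(X/W)$, $P = \pi_1(X)$. Each $\sigma \in B$ lifts to a homotopy class of paths $\gamma_\sigma$ in $X$ from $\underline{z}$ to $\pi(\sigma).\underline{z}$, where $\pi : B \to W$ is the natural surjective morphism with kernel $P$; the product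 $\sigma\tau$ lifts to $\gamma_\sigma$ followed by $\pi(\sigma).\gamma_\tau$. Put $\omega_H = d\alpha_H/\alpha_H$ (independent of the choice of $\alpha_H$). Let $\mathbb{C}\mathcal{A}$ have basis $(v_H)_{H\in\mathcal{A}}$, let $W$ act on it by $R_0(w)v_H = v_{w(H)}$, and let $p_H$ be the projector with $p_H v_H = v_H$, $p_H v_{H'} = 0$ for $H' \neq H$. For $h \in \mathbb{C}$ define $R_h : B \to \mathrm{GL}(\mathbb{C}\mathcal{A})$ by $$R_h(\sigma) = \Big(\prod_{H \in \mathcal{A}} \exp\big(h\, p_H \int_{\gamma_\sigma} \omega_H\big)\Big) R_0(\pi(\sigma)),$$ which is the monodromy representation attached to the flat $W$-equivariant connection form $h\sum_H p_H\omega_H$. $R_0$ is viewed as a representation of $B$ via $\pi$. *)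

(* Defs.v *)
From HB Require Import structures.
From mathcomp Require Import all_boot all_order all_algebra finmap complex.
From mathcomp Require Import generic_quotient.
From mathcomp Require Import all_classical all_reals all_analysis.

Set Implicit Arguments.
Unset Strict Implicit.
Unset Printing Implicit Defensive.

Import Order.TTheory GRing.Theory Num.Theory numFieldNormedType.Exports.

Local Open Scope classical_set_scope.
Local Open Scope ring_scope.
Local Open Scope quotient_scope.

(* R[i] packed as a numClosedFieldType: under this name it is found by the
   canonical topology that MathComp-Analysis puts on number fields. *)
Definition Cx (R : realType) : numClosedFieldType := R[i].

Definition Cx_of_real (R : realType) (x : R) : Cx R := Complex x 0.

Section ReflectionGroups.
Context (R : realType) (n : nat).
Local Notation V := 'cV[Cx R]_n.

Definition is_GL_subgroup (G : set 'M[Cx R]_n) : Prop :=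
  [/\ G 1%:M,
      forall g, G g -> g \in unitmx /\ G (invmx g)
    & forall g h, G g -> G h -> G (g *m h)].

Definition fixed_space (g : 'M[Cx R]_n) : {vspace V} :=
  lker (linfun (mulmx (g - 1%:M) : V -> V)).

Definition is_reflection (s : 'M[Cx R]_n) : Prop :=
  (exists2 k : nat, (0 < k)%N & s ^+ k = 1%:M)
  /\ (\dim (fixed_space s)).+1 = n.

Definition generated_by_reflections (W : set 'M[Cx R]_n) : Prop :=
  exists2 S : set 'M[Cx R]_n,
    S `<=` [set s | is_reflection s] & W = smallest is_GL_subgroup S.

Definition arrangement (W : {fset 'M[Cx R]_n}) : {fset {vspace V}} :=
  [fset fixed_space s | s in W & `[< is_reflection s >]]%fset.

Definition essential (A : {fset {vspace V}}) : Prop :=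
  (\bigcap_(H : A) val H)%VS = 0%VS.

Definition regular_part (W : {fset 'M[Cx R]_n}) : set V :=
  [set v | forall H : arrangement W, v \notin val H].

Definition acts_freely (W : {fset 'M[Cx R]_n}) (X : set V) : Prop :=
  forall w v, w \in W -> X v -> w *m v = v -> w = 1%:M.

Definition kappa_set (W : {fset 'M[Cx R]_n}) (e : arrangement W -> V) :
    set nat :=
  [set m | (0 < m)%N /\
     forall w (H : arrangement W) (zeta : Cx R),
       w \in W -> w *m e H = zeta *: e H -> zeta ^+ m = 1].

Definition is_minimum (E : set nat) (k : nat) : Prop :=
  E k /\ forall m, E m -> (k <= m)%N.

End ReflectionGroups.

Section OrbitSpace.
Context (R : realType) (n : nat) (W : {fset 'M[Cx R]_n}) (X : set 'cV[Cx R]_n).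

Definition orbit_of (v : 'cV[Cx R]_n) : {fset 'cV[Cx R]_n} :=
  [fset w *m v | w in W]%fset.

Definition same_orbit : rel X := fun x y => orbit_of (val x) == orbit_of (val y).

Lemma same_orbit_refl : reflexive same_orbit.
Proof. by move=> x; exact: eqxx. Qed.

Lemma same_orbit_sym : symmetric same_orbit.
Proof. by move=> x y; exact: eq_sym. Qed.

Lemma same_orbit_trans : transitive same_orbit.
Proof. by move=> y x t /eqP xy /eqP yt; apply/eqP; rewrite xy. Qed.

Definition same_orbit_equiv : equiv_rel X :=
  EquivRel same_orbit same_orbit_refl same_orbit_sym same_orbit_trans.

Definition orbit_space : topologicalType :=
  quotient_topology {eq_quot same_orbit_equiv}.

(* The projection X -> X/W, made total on the ambient space: vectors outside
   X are sent to the class of z. *)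
Definition orbit_proj (z : X) (v : 'cV[Cx R]_n) : orbit_space :=
  \pi_({eq_quot same_orbit_equiv}) (insubd z v).

End OrbitSpace.

(* Paths are functions on the real line of which only the restriction to
   [0, 1] matters.  Elements of pi1 y are homotopy classes, rel endpoints, of
   loops at y. *)
Section FundamentalGroup.
Context (R : realType) (Y : topologicalType).

Definition is_loop (y : Y) (f : R -> Y) : Prop :=
  [/\ {within `[0, 1], continuous f}, f 0 = y & f 1 = y].

Definition path_homotopic (f g : R -> Y) : Prop :=
  exists F : R * R -> Y,
    [/\ {within `[0, 1] `*` `[0, 1], continuous F},
        forall t, t \in `[0, 1] -> F (0, t) = f t /\ F (1, t) = g t
      & forall s, s \in `[0, 1] -> F (s, 0) = f 0 /\ F (s, 1) = f 1].

Definition pi1 (y : Y) : set (set (R -> Y)) :=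
  [set c | exists2 f, is_loop y f
                    & c = [set g | is_loop y g /\ path_homotopic f g]].

End FundamentalGroup.

Section LineIntegrals.
Context (R : realType).

Definition C1 (f : R -> R) : Prop :=
  (forall t, derivable f t 1) /\ continuous (derive1 f).

Definition C1_path (n : nat) (g : R -> 'cV[Cx R]_n) : Prop :=
  forall i, C1 (fun t => complex.Re (g t i 0))
         /\ C1 (fun t => complex.Im (g t i 0)).

Definition path_deriv (n : nat) (g : R -> 'cV[Cx R]_n) (t : R) : 'cV[Cx R]_n :=
  \col_i Complex (derive1 (fun u => complex.Re (g u i 0)) t)
                 (derive1 (fun u => complex.Im (g u i 0)) t).

Definition integral01 (f : R -> Cx R) : Cx R :=
  Complex (\int[lebesgue_measure]_(t in `[0, 1]) complex.Re (f t))%R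
          (\int[lebesgue_measure]_(t in `[0, 1]) complex.Im (f t))%R.

(* Integral along g of the 1-form d alpha / alpha. *)
Definition dlog_integral (n : nat) (alpha : 'Hom('cV[Cx R]_n, (Cx R)^o))
    (g : R -> 'cV[Cx R]_n) : Cx R :=
  integral01 (fun t => alpha (path_deriv g t) / alpha (g t)).

Definition expmx (N : nat) (M : 'M[Cx R]_N) : 'M[Cx R]_N :=
  limn (series (fun k => (k`!%:R)^-1 *: M ^+ k)).

End LineIntegrals.

Section Monodromy.
Context (R : realType) (n : nat) (W : {fset 'M[Cx R]_n}).
Local Notation A := (arrangement W).
Local Notation X := (regular_part W).
Context (z : X).

Definition braid_group : set (set (R -> orbit_space W X)) :=
  pi1 (R := R) (orbit_proj W z (val z)).

(* A path in X starting at z and lifting sigma.  Its homotopy class is determined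
   by sigma, and contains C^1 paths, along which the closed forms
   d alpha / alpha can be integrated.  The default values of lift_path and
   braid_proj are not used when sigma is in braid_group and W acts freely
   on X. *)
Definition lift_path (sigma : set (R -> orbit_space W X)) :
    R -> 'cV[Cx R]_n :=
  xget (fun=> val z)
    [set g | [/\ C1_path g, forall t, t \in `[0, 1] -> X (g t),
                 g 0 = val z & sigma (fun t => orbit_proj W z (g t))]].

Definition braid_proj (sigma : set (R -> orbit_space W X)) : 'M[Cx R]_n :=
  xget 1%:M [set w | w \in W /\ lift_path sigma 1 = w *m val z].

(* Endomorphisms of C A are square matrices of size #|A| acting on columns,
   in the basis v_H := delta_mx (enum_rank H) 0. *)
Definition R0 (w : 'M[Cx R]_n) : 'M[Cx R]_#|{: A}| :=
  \matrix_(i, j)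
    (val (enum_val i) == (linfun (mulmx w) @: val (enum_val j))%VS)%:R.

Definition projector (H : A) : 'M[Cx R]_#|{: A}| :=
  delta_mx (enum_rank H) (enum_rank H).

Definition Rh (alpha : A -> 'Hom('cV[Cx R]_n, (Cx R)^o)) (h : Cx R)
    (sigma : set (R -> orbit_space W X)) : 'M[Cx R]_#|{: A}| :=
  (\prod_(H : A)
     expmx ((h * dlog_integral (alpha H) (lift_path sigma)) *: projector H))
  *m R0 (braid_proj sigma).

(* Isomorphism of representations of the braid group on C A, i.e. existence of
   an invertible intertwiner. *)
Definition rep_iso (rho rho' : set (R -> orbit_space W X) ->
    'M[Cx R]_#|{: A}|) : Prop :=
  exists2 Q : 'M[Cx R]_#|{: A}|, Q \in unitmx
    & forall sigma, braid_group sigma -> Q *m rho sigma = rho' sigma *m Q.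

End Monodromy.

(* Main.v *)
(* The operator R_h(sigma) is monomial, with entry exp(h int omega_{wH}) at
   (wH, H), w = pi(sigma), and exp(int omega_H) = alpha_H(w z) / alpha_H(z).
   For an integer m this makes R_m the conjugate, by the diagonal matrix of the
   alpha_H(z)^m, of a representation of W whose entries are the m-th powers of
   the factors by which W permutes the forms alpha_H.  For m = kappa these
   powers are trivial on the stabilizer of each hyperplane, hence form a
   coboundary, and a diagonal matrix intertwines R_{h+kappa} and R_h.

   Conversely, let R_c be isomorphic to R_0 with c > 0.  The loop
   exp(2 pi i t) z gives exp(2 pi i c) = 1, so c = m is an integer.  Comparing
   the traces of R_m and R_0 over w, the sum of the zeta_H^m over the
   hyperplanes H fixed by w, where w e_H = zeta_H e_H, equals the number of
   these hyperplanes; as the zeta_H are roots of unity, zeta_H^m = 1 for all of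
   them, so kappa <= m.  This direction needs that the end point of a lift and
   the variation of arg alpha_H along it depend only on the homotopy class of
   the loop in X/W: both are followed along a fine grid over a homotopy. *)
Require Import Defs.
From HB Require Import structures.
From mathcomp Require Import all_boot all_order all_algebra finmap complex.
From mathcomp Require Import generic_quotient ring lra.
From mathcomp Require Import all_classical all_reals all_analysis.

Set Implicit Arguments.
Unset Strict Implicit.
Unset Printing Implicit Defensive.

Import Order.TTheory GRing.Theory Num.Theory numFieldNormedType.Exports.

Local Open Scope classical_set_scope.
Local Open Scope ring_scope.

(** * Complex exponential *)

(** [Rh] is evaluated on one lift picked by choice, of which only this is known: its projection lies
    in the given homotopy class. For integer multiples of the integrals this suffices, since exp(int
    omega_H) is a ratio of values of alpha_H at the two ends of that same lift. Minimality is
    harder: for real c the number exp(c int omega_H) depends on the integral itself, not on its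
    class modulo 2 pi i, and the lift chosen for the class of an explicit path has to be controlled.
    Hence homotopy invariance is proved for pairs (point, real argument of alpha_H), which amounts
    to lifting through a covering of X on which arg alpha_H is single-valued. An isomorphism of R_m
    with R_0 has no reason to be diagonal in the basis v_H, so single entries cannot be compared;
    traces can, and |zeta_H^m| = 1 then separates the summands. *)

Section RealDerivatives.
Context {R : realType}.
Implicit Types (f g : R -> R) (t : R).

Lemma is_derive1D f g t a b : is_derive t 1 f a -> is_derive t 1 g b ->
  is_derive t 1 (fun s => f s + g s) (a + b).
Proof. exact: is_deriveD. Qed.

Lemma is_derive1B f g t a b : is_derive t 1 f a -> is_derive t 1 g b ->
  is_derive t 1 (fun s => f s - g s) (a - b).
Proof. exact: is_deriveB. Qed.

Lemma is_derive1M f g t a b : is_derive t 1 f a -> is_derive t 1 g b ->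
  is_derive t 1 (fun s => f s * g s) (a * g t + f t * b).
Proof.
move=> fa gb; apply: is_derive_eq (is_deriveM fa gb) _.
by rewrite /GRing.scale /=; ring.
Qed.

Lemma is_derive1Zl (k : R) f t a :
  is_derive t 1 f a -> is_derive t 1 (fun s => k * f s) (k * a).
Proof. by move=> fa; exact: is_deriveZ. Qed.

Lemma is_derive1_cst (k : R) t : is_derive t 1 (fun _ => k) 0.
Proof. exact: is_derive_cst. Qed.

Lemma is_derive1_id t : is_derive t 1 (fun s : R => s) 1.
Proof. exact: is_derive_id. Qed.

Lemma is_derive1_expn (n : nat) t :
  is_derive t 1 (fun s : R => s ^+ n.+1 / n.+1`!%:R) (t ^+ n / n`!%:R).
Proof.
have fn0 (k : nat) : k`!%:R != 0 :> R by rewrite pnatr_eq0 -lt0n fact_gt0.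
have := @is_deriveX R R id n.+1 t 1 1 (is_derive_id _ _).
move=> /(is_derive1Zl (n.+1`!%:R)^-1) dX.
rewrite (_ : (fun s => _) = (fun s : R => (n.+1`!%:R)^-1 * (id ^+ n.+1) s)); last first.
  by apply/funext => s; rewrite mulrC fctE.
apply: is_derive_eq dX _; rewrite /GRing.scale /= mulr1 factS natrM.
have := fn0 n; have : n.+1%:R != 0 :> R by rewrite pnatr_eq0.
by move=> n1 n2; field; rewrite n2 addrC natr1.
Qed.

Lemma is_derive1_continuous f t a : is_derive t 1 f a -> {for t, continuous f}.
Proof. by move=> [df _]; apply/differentiable_continuous/derivable1_diffP. Qed.

(** Monotonicity of K t^(n+1)/(n+1)! + s f for s = 1 and s = -1: the derivative is nonnegative by
    the bound on [df]. This is one integration step of a Taylor remainder estimate. *)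
Lemma derive_le_expn f (df : R -> R) (K : R) (n : nat) :
  (forall t, is_derive t 1 f (df t)) -> f 0 = 0 ->
  (forall t, 0 <= t -> t <= 1 -> `|df t| <= K * (t ^+ n / n`!%:R)) ->
  forall t, 0 <= t -> t <= 1 -> `|f t| <= K * (t ^+ n.+1 / n.+1`!%:R).
Proof.
move=> fdf f0 dfK t t0 t1.
have key (s : R) : s = 1 \/ s = -1 -> 0 <= K * (t ^+ n.+1 / n.+1`!%:R) + s * f t.
  move=> s1; pose g (u : R) : R := K * (u ^+ n.+1 / n.+1`!%:R) + s * f u.
  have dg (u : R) : is_derive u 1 g (K * (u ^+ n / n`!%:R) + s * df u).
    by apply: is_derive1D; apply: is_derive1Zl => //; exact: is_derive1_expn.
  have : g 0 <= g t.
    apply: (@ger0_derive1_ndecr _ g 0 1) => //.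
    - move=> u; rewrite in_itv/= => /andP[u0 u1].
      rewrite derive1E; have [_ ->] := dg u.
      have := dfK u (ltW u0) (ltW u1); rewrite ler_norml => /andP[a b].
      by case: s1 => ->; lra.
    - by apply: continuous_subspaceT => u; exact: is_derive1_continuous (dg u).
  by rewrite /g f0 exprS mul0r mul0r !mulr0 addr0.
have := key 1 (or_introl erefl); have := key (-1) (or_intror erefl).
by rewrite ler_norml; move=> a b; apply/andP; split; lra.
Qed.

End RealDerivatives.

Section ComplexExponential.
Context {R : realType}.

(** The polar form reduces [expcD] and the derivatives to real functions; agreement with the
    exponential series is [expc_cvg]. *)
Definition expc (a : Cx R) : Cx R :=
  Complex (expR (complex.Re a) * cos (complex.Im a))
          (expR (complex.Re a) * sin (complex.Im a)).

Lemma expc0 : expc 0 = 1.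
Proof. by rewrite /expc /= expR0 cos0 sin0 mulr1 mulr0. Qed.

Lemma expcD a b : expc (a + b) = expc a * expc b.
Proof.
case: a => [x y]; case: b => [u v]; rewrite /expc /=.
rewrite expRD cosD sinD; apply/eqP; rewrite eq_complex /=.
by apply/andP; split; apply/eqP; ring.
Qed.

Lemma expc_neq0 a : expc a != 0.
Proof.
apply/eqP => a0; have := expcD a (- a); rewrite subrr expc0 a0 mul0r.
by move/eqP; rewrite oner_eq0.
Qed.

Lemma expcMn a (n : nat) : expc (a *+ n) = expc a ^+ n.
Proof.
by elim: n => [|n IH]; rewrite ?expc0 ?mulrS ?expcD ?IH // exprS.
Qed.

(* The tails of the exponential series satisfy tail_{n+1}' = a tail_n along
   t |-> t a, which bounds them by induction on n. *)
Definition exp_tail_re (a : Cx R) (n : nat) (t : R) : R :=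
  expR (t * complex.Re a) * cos (t * complex.Im a)
  - \sum_(k < n) complex.Re (a ^+ k) * (t ^+ k / k`!%:R).
Definition exp_tail_im (a : Cx R) (n : nat) (t : R) : R :=
  expR (t * complex.Re a) * sin (t * complex.Im a)
  - \sum_(k < n) complex.Im (a ^+ k) * (t ^+ k / k`!%:R).

Lemma ReMc (a b : Cx R) :
  complex.Re (a * b) = complex.Re a * complex.Re b - complex.Im a * complex.Im b.
Proof. by case: a => ? ?; case: b. Qed.

Lemma ImMc (a b : Cx R) :
  complex.Im (a * b) = complex.Re a * complex.Im b + complex.Im a * complex.Re b.
Proof. by case: a => ? ?; case: b. Qed.

(** The coefficients shift by one and the constant term disappears. For F k the real or imaginary
    part of a^k, the shift is multiplication by a, which yields the recursion of the tails. *)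
Lemma is_derive_exp_sum (F : nat -> R) (n : nat) (t : R) :
  is_derive t 1 (fun s => \sum_(k < n.+1) F k * (s ^+ k / k`!%:R))
            (\sum_(k < n) F k.+1 * (t ^+ k / k`!%:R)).
Proof.
elim: n => [|n IH].
  rewrite (_ : (fun s => _) = (fun _ => F 0)); last first.
    by apply/funext => s; rewrite big_ord_recr big_ord0 /= add0r expr0 fact0 divr1 mulr1.
  by rewrite big_ord0; exact: is_derive1_cst.
rewrite (_ : (fun s => _) = (fun s => \sum_(k < n.+1) F k * (s ^+ k / k`!%:R)
    + F n.+1 * (s ^+ n.+1 / n.+1`!%:R))); last first.
  by apply/funext => s; rewrite big_ord_recr.
rewrite big_ord_recr /=; apply: is_derive1D => //.
by apply: is_derive1Zl; exact: is_derive1_expn.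
Qed.

Lemma is_derive_mulr (c t : R) : is_derive t 1 (fun s => s * c) c.
Proof.
rewrite (_ : (fun s => _) = (fun s => c * s)); last by apply/funext => s; exact: mulrC.
apply: is_derive_eq (is_derive1Zl c (is_derive1_id t)) _; exact: mulr1.
Qed.

Lemma is_derive_polar (a : Cx R) (t : R) :
  is_derive t 1 (fun s => expR (s * complex.Re a) * cos (s * complex.Im a))
    (complex.Re a * (expR (t * complex.Re a) * cos (t * complex.Im a))
     - complex.Im a * (expR (t * complex.Re a) * sin (t * complex.Im a))) /\
  is_derive t 1 (fun s => expR (s * complex.Re a) * sin (s * complex.Im a))
    (complex.Re a * (expR (t * complex.Re a) * sin (t * complex.Im a))
     + complex.Im a * (expR (t * complex.Re a) * cos (t * complex.Im a))).
Proof.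
have dE := is_derive1_comp (is_derive_expR _) (is_derive_mulr (complex.Re a) t).
have dc := is_derive1_comp (is_derive_cos _) (is_derive_mulr (complex.Im a) t).
have ds := is_derive1_comp (is_derive_sin _) (is_derive_mulr (complex.Im a) t).
split.
  by apply: is_derive_eq (is_derive1M dE dc) _; rewrite /=; ring.
by apply: is_derive_eq (is_derive1M dE ds) _; rewrite /=; ring.
Qed.

Lemma is_derive_exp_tail_re (a : Cx R) n (t : R) : is_derive t 1 (exp_tail_re a n.+1)
  (complex.Re a * exp_tail_re a n t - complex.Im a * exp_tail_im a n t).
Proof.
apply: is_derive_eq (is_derive1B (is_derive_polar a t).1 (is_derive_exp_sum (fun k =>
  complex.Re (a ^+ k)) n t)) _.
have -> : \sum_(k < n) complex.Re (a ^+ k.+1) * (t ^+ k / k`!%:R) =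
    complex.Re a * \sum_(k < n) complex.Re (a ^+ k) * (t ^+ k / k`!%:R)
    - complex.Im a * \sum_(k < n) complex.Im (a ^+ k) * (t ^+ k / k`!%:R).
  rewrite !mulr_sumr -sumrB; apply: eq_bigr => k _.
  by rewrite exprS ReMc mulrBl !mulrA.
by rewrite /exp_tail_re /exp_tail_im; ring.
Qed.

Lemma is_derive_exp_tail_im (a : Cx R) n (t : R) : is_derive t 1 (exp_tail_im a n.+1)
  (complex.Re a * exp_tail_im a n t + complex.Im a * exp_tail_re a n t).
Proof.
apply: is_derive_eq (is_derive1B (is_derive_polar a t).2 (is_derive_exp_sum (fun k =>
  complex.Im (a ^+ k)) n t)) _.
have -> : \sum_(k < n) complex.Im (a ^+ k.+1) * (t ^+ k / k`!%:R) =
    complex.Re a * \sum_(k < n) complex.Im (a ^+ k) * (t ^+ k / k`!%:R)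
    + complex.Im a * \sum_(k < n) complex.Re (a ^+ k) * (t ^+ k / k`!%:R).
  rewrite !mulr_sumr -big_split /=; apply: eq_bigr => k _.
  by rewrite exprS ImMc mulrDl !mulrA.
by rewrite /exp_tail_re /exp_tail_im; ring.
Qed.

Lemma exp_tail0 a n : exp_tail_re a n.+1 0 = 0 /\ exp_tail_im a n.+1 0 = 0.
Proof.
rewrite /exp_tail_re /exp_tail_im !mul0r expR0 cos0 sin0 mulr1 mulr0 !big_ord_recl /= expr0
  fact0.
rewrite !big1 ?addr0 /= ?expr0 ?divr1 ?mulr1 ?mulr0 ?subrr ?subr0 //.
  by move=> i _; rewrite [0 ^+ _]expr0n mul0r mulr0.
by move=> i _; rewrite [0 ^+ _]expr0n mul0r mulr0.
Qed.

(* A real-valued substitute for the norm of [Cx R], which takes its values in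
   [Cx R]. *)
Definition absc1 (a : Cx R) : R := `|complex.Re a| + `|complex.Im a|.

(** For n = 0 the factor exp(t Re a) is at most exp([absc1 a]) because t <= 1; each further step
    integrates a times the previous tail by [derive_le_expn]. *)
Lemma exp_tail_bound a n (t : R) : 0 <= t -> t <= 1 ->
  `|exp_tail_re a n t| <= expR (absc1 a) * absc1 a ^+ n * (t ^+ n / n`!%:R) /\
  `|exp_tail_im a n t| <= expR (absc1 a) * absc1 a ^+ n * (t ^+ n / n`!%:R).
Proof.
elim: n t => [|n IH] t t0 t1.
  rewrite /exp_tail_re /exp_tail_im !big_ord0 !subr0 !expr0 fact0 divr1 !mulr1.
  have le1 (u : R) : `|u| <= 1 -> `|expR (t * complex.Re a) * u| <= expR (absc1 a).
    move=> u1; rewrite normrM -[leRHS]mulr1; apply: ler_pM => //.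
    rewrite ger0_norm ?expR_ge0// ler_expR /absc1.
    have := ler_norm (complex.Re a); have := normr_ge0 (complex.Im a).
    have := normr_ge0 (complex.Re a); nra.
  by split; apply: le1; rewrite ler_norml ?cos_geN1 ?cos_le1 ?sin_geN1 ?sin_le1.
have L0 : 0 <= absc1 a by rewrite addr_ge0.
(* Each component of a times a tail combines Re a and Im a with the two components of the tail, so a
   common bound B on the latter gives [absc1 a * B]. *)
have step (f g : R) (B : R) : `|f| <= B -> `|g| <= B ->
    `|complex.Re a * f| + `|complex.Im a * g| <= absc1 a * B.
  by move=> fB gB; rewrite !normrM /absc1 mulrDl lerD// ler_wpM2l.
have [R0 I0] := exp_tail0 a n.
split.
  apply: (derive_le_expn (is_derive_exp_tail_re a n)) => // s s0 s1.
  have [rs is_] := IH s s0 s1; apply: le_trans (ler_normB _ _) _.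
  by apply: le_trans (step _ _ _ rs is_) _; rewrite exprS -!mulrA mulrCA.
apply: (derive_le_expn (is_derive_exp_tail_im a n)) => // s s0 s1.
have [rs is_] := IH s s0 s1; apply: le_trans (ler_normD _ _) _.
by apply: le_trans (step _ _ _ is_ rs) _; rewrite exprS -!mulrA mulrCA.
Qed.

(** The tail bound at t = 1; the factor 2 comes from adding the two components. *)
Lemma expc_series_bound (a : Cx R) (n : nat) :
  let r := expc a - \sum_(k < n) a ^+ k / k`!%:R in
  `|complex.Re r| + `|complex.Im r| <= 2 * expR (absc1 a) * exp_coeff (absc1 a) n.
Proof.
have [] := @exp_tail_bound a n 1 ler01 (lexx _).
have Zr (b : Cx R) (k : nat) : b / k`!%:R = Complex (complex.Re b / k`!%:R) (complex.Im b /
  k`!%:R).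
  have -> : k`!%:R = Complex k`!%:R 0 :> Cx R.
    by elim: (k`!) => // m IH; rewrite !mulrS IH; apply/eqP; rewrite eq_complex /= addr0 !eqxx.
  have kn0 : k`!%:R != 0 :> R by rewrite pnatr_eq0 -lt0n fact_gt0.
  case: b => x y; apply/eqP; rewrite eq_complex /=.
  by apply/andP; split; apply/eqP; field.
have Rs : complex.Re (\sum_(k < n) a ^+ k / k`!%:R) =
    \sum_(k < n) complex.Re (a ^+ k) * (1 ^+ k / k`!%:R).
  rewrite (big_morph (fun c : Cx R => complex.Re c) (id1 := 0) (op1 := +%R)) //;
    last by case=> ? ? [].
  by apply: eq_bigr => k _; rewrite Zr expr1n mul1r.
have Is : complex.Im (\sum_(k < n) a ^+ k / k`!%:R) =
    \sum_(k < n) complex.Im (a ^+ k) * (1 ^+ k / k`!%:R).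
  rewrite (big_morph (fun c : Cx R => complex.Im c) (id1 := 0) (op1 := +%R)) //;
    last by case=> ? ? [].
  by apply: eq_bigr => k _; rewrite Zr expr1n mul1r.
rewrite /exp_tail_re /exp_tail_im -Rs -Is !mul1r expr1n mul1r => r i.
have -> : complex.Re (expc a - \sum_(k < n) a ^+ k / k`!%:R) =
  complex.Re (expc a) - complex.Re (\sum_(k < n) a ^+ k / k`!%:R).
  by case: (\sum_(_ < _) _).
have -> : complex.Im (expc a - \sum_(k < n) a ^+ k / k`!%:R) =
  complex.Im (expc a) - complex.Im (\sum_(k < n) a ^+ k / k`!%:R).
  by case: (\sum_(_ < _) _).
apply: le_trans (lerD r i) _.
by rewrite /exp_coeff -!mulrA -mulr2n -[leLHS]mulr_natl.
Qed.

End ComplexExponential.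

(** * Convergence in [Cx R] and the exponential of a multiple of a projector *)

Section ComplexTopology.
Context {R : realType}.

Lemma norm_le_absc1 (a : Cx R) : `|a| <= Cx_of_real (absc1 a).
Proof.
rewrite normc_def lecE /= eqxx /= /absc1.
have r0 := normr_ge0 (complex.Re a); have i0 := normr_ge0 (complex.Im a).
rewrite -[leRHS]ger0_norm ?addr_ge0// -[leRHS]sqrtr_sqr; apply: ler_wsqrtr.
by rewrite -[complex.Re a ^+ 2]real_normK ?num_real// -[complex.Im a ^+ 2]real_normK
  ?num_real//; nra.
Qed.

Lemma cx_gt0P (e : Cx R) : 0 < e -> exists2 e' : R, 0 < e' & e = Cx_of_real e'.
Proof. by case: e => x y; rewrite ltcE /= => /andP[/eqP-> x0]; exists x. Qed.

Lemma cvg_absc1 T (F : set_system T) (f : T -> Cx R) (l : Cx R) : Filter F ->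
  (forall e : R, 0 < e -> \forall t \near F, absc1 (l - f t) < e) -> f @ F --> l.
Proof.
move=> FF fl; apply/cvgrPdist_lt => e /cx_gt0P[e' e'0 ->].
apply: filterS (fl e' e'0) => t fte; apply: le_lt_trans (norm_le_absc1 _) _.
by rewrite ltcE /= eqxx.
Qed.

Lemma ReDc (a b : Cx R) : complex.Re (a + b) = complex.Re a + complex.Re b.
Proof. by case: a; case: b. Qed.

Lemma ImDc (a b : Cx R) : complex.Im (a + b) = complex.Im a + complex.Im b.
Proof. by case: a; case: b. Qed.

Lemma ReNc (a : Cx R) : complex.Re (- a) = - complex.Re a.
Proof. by case: a. Qed.

Lemma ImNc (a : Cx R) : complex.Im (- a) = - complex.Im a.
Proof. by case: a. Qed.

Lemma absc1N (a : Cx R) : absc1 (- a) = absc1 a.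
Proof. by rewrite /absc1 ReNc ImNc !normrN. Qed.

Lemma absc1D (a b : Cx R) : absc1 (a + b) <= absc1 a + absc1 b.
Proof. by rewrite /absc1 ReDc ImDc addrACA lerD// ler_normD. Qed.

Lemma absc1M (a b : Cx R) : absc1 (a * b) <= absc1 a * absc1 b.
Proof.
rewrite /absc1 ReMc ImMc mulrDl !mulrDr -!normrM.
have := ler_normB (complex.Re a * complex.Re b) (complex.Im a * complex.Im b).
have := ler_normD (complex.Re a * complex.Im b) (complex.Im a * complex.Re b).
lra.
Qed.

Lemma absc1_eq0 (a : Cx R) : absc1 a = 0 -> a = 0.
Proof.
case: a => x y /eqP; rewrite /absc1 paddr_eq0// !normr_eq0 /=.
by move=> /andP[/eqP-> /eqP->].
Qed.

Lemma nbhs_absc1 (a : Cx R) (e : R) : 0 < e -> \forall b \near a, absc1 (a - b) < e.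
Proof.
move=> e0; have e20 : 0 < Cx_of_real (e / 2) by rewrite ltcE /= eqxx /= divr_gt0.
have /nbhs_ballP : exists2 r, 0 < r & ball a r `<=` ball a (Cx_of_real (e / 2)) by exists
  (Cx_of_real (e / 2)).
apply: filterS => b; rewrite -ball_normE /= normc_def ltcE /= => /andP[_ abe].
have ReIm (x : R) : x ^+ 2 <= complex.Re (a - b) ^+ 2 + complex.Im (a - b) ^+ 2 ->
    `|x| < e / 2.
  move=> xle; apply: le_lt_trans abe; rewrite -sqrtr_sqr; apply: ler_wsqrtr.
  exact: xle.
have := ReIm (complex.Re (a - b)); have := ReIm (complex.Im (a - b)).
rewrite lerDl lerDr !sqr_ge0 /absc1 => /(_ isT) + /(_ isT); lra.
Qed.

Lemma cvg_coord T (F : set_system T) m n (f : T -> 'M[Cx R]_(m, n)) (l : 'M[Cx R]_(m, n)) :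
  Filter F ->
  (forall i j, f x i j @[x --> F] --> l i j) -> f @ F --> l.
Proof.
move=> FF fl A [P lP PA]; rewrite /= nbhs_filterE /fmap /=.
have : \forall x \near F, forall i j, P i j (f x i j).
  by do 2 (apply: filter_forall => ?); exact: fl (lP _ _).
by apply: filterS => x Px; exact: PA.
Qed.

Lemma mx_hausdorff m n : hausdorff_space 'M[Cx R]_(m, n).
Proof.
move=> A B AB; apply/matrixP => i j; apply: (@norm_hausdorff _ (Cx R)) => P Q AP BQ.
have [M [PM QM]] := AB _ _ (@coord_continuous _ m n i j A P AP)
  (@coord_continuous _ m n i j B Q BQ).
by exists (M i j).
Qed.

Lemma expc_cvg (a : Cx R) :
  (\sum_(k < n) a ^+ k / k`!%:R) @[n --> \oo] --> expc a.
Proof.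
apply: cvg_absc1 => e e0.
have bnd0 : 2 * expR (absc1 a) * exp_coeff (absc1 a) n @[n --> \oo] --> (0 : R).
  have := cvgM (cvg_cst (2 * expR (absc1 a)) (F := \oo)) (cvg_exp_coeff (absc1 a)).
  by rewrite mulr0; apply.
apply: filterS (@cvgr0_norm_lt _ _ _ _ _ _ bnd0 _ e0) => n.
by apply: le_lt_trans; apply: le_trans (expc_series_bound a n) (ler_norm _).
Qed.

Lemma cvg_affine (u : nat -> Cx R) (l c d : Cx R) :
  u n @[n --> \oo] --> l -> c + (u n - 1) * d @[n --> \oo] --> c + (l - 1) * d.
Proof.
move=> ul; apply: (@cvgD _ (Cx R) _ _ _ (fun=> c) (fun n => (u n - 1) * d) c _ _ _).
  exact: cvg_cst.
apply: (@cvgM (Cx R) _ _ _ (fun n => u n - 1) (fun=> d) _ d); last exact: cvg_cst.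
exact: (@cvgB _ (Cx R) _ _ _ u (fun=> 1) l 1 ul (@cvg_cst (Cx R) 1 nat \oo _)).
Qed.

(** The matrix unit is idempotent, so every term after the identity is a multiple of it, and the
    scalar series that remains is exp(a) - 1. *)
Lemma expmx_delta N (i : 'I_N) (a : Cx R) :
  expmx (a *: delta_mx i i) = 1%:M + (expc a - 1) *: delta_mx i i.
Proof.
apply: cvg_lim; first exact: mx_hausdorff.
have expP k : (a *: delta_mx i i : 'M[Cx R]_N) ^+ k.+1 = a ^+ k.+1 *: delta_mx i i.
  elim: k => [|k IH] //; rewrite exprS IH -mulmxE -scalemxAl -scalemxAr scalerA.
  by rewrite mul_delta_mx -exprS.
have sumE n : series (fun k => (k`!%:R)^-1 *: (a *: delta_mx i i : 'M[Cx R]_N) ^+ k) n.+1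
    = 1%:M + (\sum_(k < n.+1) a ^+ k / k`!%:R - 1) *: delta_mx i i.
  rewrite /series /= big_mkord !big_ord_recl /= !expr0 fact0 invr1 scale1r mulr1.
  rewrite addrAC subrr add0r scaler_suml; congr (_ + _); apply: eq_bigr => k _.
  by rewrite expP scalerA mulrC.
(* Partial sums are shifted to length n + 1, so that each contains the identity term. *)
rewrite -cvg_shiftS /=; under eq_fun do rewrite sumE.
apply: cvg_coord => k l; rewrite !mxE.
under eq_fun do rewrite !mxE.
have S : (\sum_(k < n.+1) a ^+ k / k`!%:R) @[n --> \oo] --> expc a.
  by have := @expc_cvg a; rewrite -cvg_shiftS.
exact: (@cvg_affine (fun m => \sum_(k0 < m.+1) a ^+ k0 / k0`!%:R) _ _ _ S).
Qed.

End ComplexTopology.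

(** * Logarithmic integrals along paths *)

Section Primitive.
Context {R : realType}.
Local Notation mu := (@lebesgue_measure R).

Lemma derive0_itv_cst (f : R -> R) :
  {within `[0, 1], continuous f} ->
  (forall t : R, t \in `]0, 1[ -> is_derive t 1 f 0) ->
  forall t : R, t \in `[0, 1] -> f t = f 0.
Proof.
move=> cf df t; rewrite in_itv /= => /andP[t0 t1].
move: t0; rewrite le_eqVlt => /predU1P[<-//|t0].
have [||c _] := @MVT R f (fun=> 0) 0 t t0.
- by move=> x; rewrite in_itv /= => /andP[x0 xt]; apply: df;
  rewrite in_itv /= x0 (lt_le_trans xt).
- by apply: continuous_subspaceW cf; apply: subset_itvl; rewrite bnd_simp.
- by rewrite mul0r => /eqP; rewrite subr_eq0 => /eqP.
Qed.

(** Integration from 0. The derivative is claimed only inside the interval, and continuity up to its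
    ends, which is the form that [derive0_itv_cst] consumes. *)
Lemma integral_primitive (r : R -> R) :
  (forall t : R, t \in `[0, 1] -> {for t, continuous r}) ->
  exists P : R -> R, [/\ {within `[0, 1], continuous P}, P 0 = 0,
      P 1 = (\int[mu]_(x in `[0, 1]) r x)%R
    & forall t : R, t \in `]0, 1[ -> is_derive t 1 P (r t)].
Proof.
move=> cr; pose P (t : R) := (\int[mu]_(x in `[0, t]) r x)%R; exists P.
have wr : {within `[0, 1], continuous r}.
  by apply: continuous_in_subspaceT => t /set_mem; exact: cr.
have ir : mu.-integrable `[0, 1] (EFin \o r).
  by apply: continuous_compact_integrable => //; exact: segment_compact.
split.
- exact: parameterized_integral_continuous.
- by rewrite /P set_itv1 Rintegral_set1.
- by [].
- move=> t; rewrite in_itv /= => /andP[t0 t1].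
  have [|dP <-] := @continuous_FTC1_closed _ r 0 t 1 t1 ir t0.
    by apply: cr; rewrite in_itv /= !ltW.
  by rewrite derive1E; apply: derivableP.
Qed.

(* f = f(0) exp(int f'/f), because f exp(- int f'/f) has derivative 0. *)
Lemma polar_lift (p q dp dq : R -> R) :
  (forall t : R, is_derive t 1 p (dp t)) -> (forall t : R, is_derive t 1 q (dq t)) ->
  continuous dp -> continuous dq ->
  (forall t : R, t \in `[0, 1] -> p t ^+ 2 + q t ^+ 2 != 0) ->
  let r (t : R) := (dp t * p t + dq t * q t) / (p t ^+ 2 + q t ^+ 2) in
  let a (t : R) := (dq t * p t - dp t * q t) / (p t ^+ 2 + q t ^+ 2) in
  exists P Q : R -> R,
  [/\ {within `[0, 1], continuous Q}, P 0 = 0 /\ Q 0 = 0,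
      P 1 = (\int[mu]_(x in `[0, 1]) r x)%R /\ Q 1 = (\int[mu]_(x in `[0, 1]) a x)%R
    & forall t : R, t \in `[0, 1] ->
        Complex (p t) (q t) = Complex (p 0) (q 0) * expc (Complex (P t) (Q t))].
Proof.
move=> pd qd cdp cdq nz r a.
have cp : continuous p by move=> t; exact: is_derive1_continuous (pd t).
have cq : continuous q by move=> t; exact: is_derive1_continuous (qd t).
have cinv (t : R) : t \in `[0, 1] -> {for t, continuous (fun s => (p s ^+ 2 + q s ^+ 2)^-1)}.
  move=> t01; apply: cvgV; first exact: nz.
  by apply: cvgD; [exact: cvgM (cp t) (cp t)|exact: cvgM (cq t) (cq t)].
have cr (t : R) : t \in `[0, 1] -> {for t, continuous r}.
  move=> t01; apply: cvgM; last exact: cinv.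
  by apply: cvgD; [exact: cvgM (cdp t) (cp t)|exact: cvgM (cdq t) (cq t)].
have ca (t : R) : t \in `[0, 1] -> {for t, continuous a}.
  move=> t01; apply: cvgM; last exact: cinv.
  by apply: cvgB; [exact: cvgM (cdq t) (cp t)|exact: cvgM (cdp t) (cq t)].
have [P [cP P0 P1 dP]] := integral_primitive cr.
have [Q [cQ Q0 Q1 dQ]] := integral_primitive ca.
exists P, Q; split=> // t t01.
have dE (s : R) : s \in `]0, 1[ -> is_derive s 1 (fun u =>
  expR (- P u)) (expR (- P s) * - r s).
  by move=> s01; apply: (@is_derive1_comp _ expR (fun u => - P u));
    exact: is_deriveN (dP s s01).
have dc (s : R) : s \in `]0, 1[ -> is_derive s 1 (fun u => cos (Q u)) (- sin (Q s) * a s).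
  by move=> s01; apply: (@is_derive1_comp _ cos Q); exact: dQ.
have ds (s : R) : s \in `]0, 1[ -> is_derive s 1 (fun u => sin (Q u)) (cos (Q s) * a s).
  by move=> s01; apply: (@is_derive1_comp _ sin Q); exact: dQ.
(* [dpE] and [dqE] say f' = (r + i a) f for f = p + i q, by components. *)
have dpE (s : R) : s \in `]0, 1[ -> dp s = r s * p s - a s * q s.
  move=> s01; have := nz s (subset_itv_oo_cc s01) => ?.
  by rewrite /r /a; field.
have dqE (s : R) : s \in `]0, 1[ -> dq s = r s * q s + a s * p s.
  move=> s01; have := nz s (subset_itv_oo_cc s01) => ?.
  by rewrite /r /a; field.
have wE : {within `[0, 1], continuous (fun u => expR (- P u))}.
  by move=> u; apply: continuous_comp; [exact: cvgN (cP u)|exact: continuous_expR].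
have wc : {within `[0, 1], continuous (fun u => cos (Q u))}.
  by move=> u; apply: continuous_comp; [exact: cQ|exact: continuous_cos].
have ws : {within `[0, 1], continuous (fun u => sin (Q u))}.
  by move=> u; apply: continuous_comp; [exact: cQ|exact: continuous_sin].
have wp : {within `[0, 1], continuous p} by exact: continuous_subspaceT.
have wq : {within `[0, 1], continuous q} by exact: continuous_subspaceT.
(* [U] and [V] are the real and imaginary parts of f exp(- P - i Q); multiplying the two constants
   by exp(P + i Q) recovers f at the end. *)
have U : expR (- P t) * (p t * cos (Q t) + q t * sin (Q t)) = p 0.
  pose U s := expR (- P s) * (p s * cos (Q s) + q s * sin (Q s)).
  transitivity (U 0); last by rewrite /U P0 Q0 oppr0 expR0 cos0 sin0 mul1r mulr1 mulr0 addr0.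
  apply: (@derive0_itv_cst U) => //.
  - move=> u; apply: cvgM; first exact: wE.
    by apply: cvgD; [exact: cvgM (wp u) (wc u)|exact: cvgM (wq u) (ws u)].
  - move=> s s01; apply: is_derive_eq (is_derive1M (dE s s01)
      (is_derive1D (is_derive1M (pd s) (dc s s01)) (is_derive1M (qd s) (ds s s01)))) _.
    by rewrite dpE// dqE//; ring.
have V : expR (- P t) * (q t * cos (Q t) - p t * sin (Q t)) = q 0.
  pose V s := expR (- P s) * (q s * cos (Q s) - p s * sin (Q s)).
  transitivity (V 0); last by rewrite /V P0 Q0 oppr0 expR0 cos0 sin0 mul1r mulr1 mulr0 subr0.
  apply: (@derive0_itv_cst V) => //.
  - move=> u; apply: cvgM; first exact: wE.
    by apply: cvgB; [exact: cvgM (wq u) (wc u)|exact: cvgM (wp u) (ws u)].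
  - move=> s s01; apply: is_derive_eq (is_derive1M (dE s s01)
      (is_derive1B (is_derive1M (qd s) (dc s s01)) (is_derive1M (pd s) (ds s s01)))) _.
    by rewrite dpE// dqE//; ring.
have PP : expR (P t) * expR (- P t) = 1 by rewrite -expRD subrr expR0.
have cs := cos2Dsin2 (Q t).
rewrite -U -V /expc /=; apply/eqP; rewrite eq_complex /=.
apply/andP; split; apply/eqP.
  transitivity ((expR (P t) * expR (- P t)) * (cos (Q t) ^+ 2 + sin (Q t) ^+ 2) * p t);
    last ring.
  by rewrite PP cs !mul1r.
transitivity ((expR (P t) * expR (- P t)) * (cos (Q t) ^+ 2 + sin (Q t) ^+ 2) * q t);
  last ring.
by rewrite PP cs !mul1r.
Qed.

End Primitive.

Section LinearForms.
Context {R : realType} {n : nat}.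
Implicit Type alpha : 'Hom('cV[Cx R]_n, (Cx R)^o).

Lemma cdiv_eq (a b : Cx R) : a / b =
  Complex ((complex.Re a * complex.Re b + complex.Im a * complex.Im b)
             / (complex.Re b ^+ 2 + complex.Im b ^+ 2))
          ((complex.Im a * complex.Re b - complex.Re a * complex.Im b)
             / (complex.Re b ^+ 2 + complex.Im b ^+ 2)).
Proof.
case: a => x y; case: b => u v; apply/eqP; rewrite eq_complex /=.
by apply/andP; split; apply/eqP; ring.
Qed.

Lemma sqrDc_neq0 (a : Cx R) :
  a != 0 -> complex.Re a ^+ 2 + complex.Im a ^+ 2 != 0.
Proof.
apply: contra; rewrite paddr_eq0 ?sqr_ge0// !sqrf_eq0.
by case: a => x y /= /andP[/eqP-> /eqP->].
Qed.

Lemma Re_sum (I : finType) (F : I -> Cx R) :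
  complex.Re (\sum_i F i) = \sum_i complex.Re (F i).
Proof. by rewrite (big_morph _ (@ReDc R) (erefl (complex.Re (0 : Cx R)))). Qed.

Lemma Im_sum (I : finType) (F : I -> Cx R) :
  complex.Im (\sum_i F i) = \sum_i complex.Im (F i).
Proof. by rewrite (big_morph _ (@ImDc R) (erefl (complex.Im (0 : Cx R)))). Qed.

Lemma linear_form_sum alpha (v : 'cV[Cx R]_n) :
  alpha v = \sum_i (v i 0 * (alpha (delta_mx i 0) : Cx R)).
Proof.
rewrite [v in LHS]matrix_sum_delta linear_sum /=; apply: eq_bigr => i _.
by rewrite big_ord1 linearZ.
Qed.

Lemma is_derive1_sum (I : finType) (f : I -> R -> R) (df : I -> R) (t : R) :
  (forall i, is_derive t 1 (f i) (df i)) ->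
  is_derive t 1 (fun s => \sum_i f i s) (\sum_i df i).
Proof.
move=> fdf; suff : forall s : seq I,
    is_derive t 1 (fun u => \sum_(i <- s) f i u) (\sum_(i <- s) df i) by [].
elim=> [|i s IH].
  rewrite big_nil; under eq_fun do rewrite big_nil.
  exact: is_derive1_cst.
rewrite big_cons; under eq_fun do rewrite big_cons.
exact: is_derive1D.
Qed.

Lemma continuous_sumr (T : topologicalType) (I : finType) (f : I -> T -> R) (x : T) :
  (forall i, {for x, continuous (f i)}) -> {for x, continuous (fun s => \sum_i f i s)}.
Proof.
move=> cf; rewrite /continuous_at /prop_for.
suff : forall s : seq I, (\sum_(i <- s) f i y) @[y --> x] --> \sum_(i <- s) f i x by [].
elim=> [|i s IH].
  rewrite big_nil; under eq_fun do rewrite big_nil.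
  exact: cvg_cst.
rewrite big_cons; under eq_fun do rewrite big_cons.
exact: cvgD (cf i) IH.
Qed.

Lemma form_path_derive alpha (g : R -> 'cV[Cx R]_n) : C1_path g ->
  [/\ forall t : R, is_derive t 1 (fun s => complex.Re (alpha (g s)))
        (complex.Re (alpha (path_deriv g t))),
      forall t : R, is_derive t 1 (fun s => complex.Im (alpha (g s)))
        (complex.Im (alpha (path_deriv g t))),
      continuous (fun t => complex.Re (alpha (path_deriv g t)))
    & continuous (fun t => complex.Im (alpha (path_deriv g t)))].
Proof.
move=> gC1.
pose a i : Cx R := alpha (delta_mx i 0).
have ReE v : complex.Re (alpha v) = \sum_i (complex.Re (v i 0) * complex.Re (a i)
    - complex.Im (v i 0) * complex.Im (a i)).
  by rewrite linear_form_sum Re_sum; apply: eq_bigr => i _; rewrite ReMc.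
have ImE v : complex.Im (alpha v) = \sum_i (complex.Re (v i 0) * complex.Im (a i)
    + complex.Im (v i 0) * complex.Re (a i)).
  by rewrite linear_form_sum Im_sum; apply: eq_bigr => i _; rewrite ImMc.
have dR i (t : R) : is_derive t 1 (fun s =>
  complex.Re (g s i 0)) (complex.Re (path_deriv g t i 0)).
  by rewrite mxE /= derive1E; apply: derivableP; exact: (gC1 i).1.1.
have dI i (t : R) : is_derive t 1 (fun s =>
  complex.Im (g s i 0)) (complex.Im (path_deriv g t i 0)).
  by rewrite mxE /= derive1E; apply: derivableP; exact: (gC1 i).2.1.
have cR i : continuous (fun t => complex.Re (path_deriv g t i 0)).
  by under eq_fun do rewrite mxE /=; exact: (gC1 i).1.2.
have cI i : continuous (fun t => complex.Im (path_deriv g t i 0)).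
  by under eq_fun do rewrite mxE /=; exact: (gC1 i).2.2.
have dMr (f : R -> R) (k t b : R) : is_derive t 1 f b -> is_derive t 1 (fun s =>
  f s * k) (b * k).
  move=> fb; apply: is_derive_eq (is_derive1M fb (is_derive1_cst k t)) _.
  by rewrite mulr0 addr0.
have cMr (f : R -> R) (k t : R) : {for t, continuous f} -> {for t, continuous (fun s =>
  f s * k)}.
  by move=> cf; exact: cvgM cf (cvg_cst _).
split.
- move=> t; rewrite ReE; under eq_fun do rewrite ReE.
  by apply: is_derive1_sum => i; apply: is_derive1B; exact: dMr.
- move=> t; rewrite ImE; under eq_fun do rewrite ImE.
  by apply: is_derive1_sum => i; apply: is_derive1D; exact: dMr.
- under eq_fun do rewrite ReE.
  move=> t; apply: continuous_sumr => i; apply: cvgB.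
    by apply: cMr; exact: cR.
  by apply: cMr; exact: cI.
- under eq_fun do rewrite ImE.
  move=> t; apply: continuous_sumr => i; apply: cvgD.
    by apply: cMr; exact: cR.
  by apply: cMr; exact: cI.
Qed.

(** [Q] is a continuous argument of alpha (g t) / alpha (g 0) that ends at the imaginary part of the
    integral itself; the first clause alone determines this number only up to multiples of 2 pi. *)
Lemma dlog_lift alpha (g : R -> 'cV[Cx R]_n) : C1_path g ->
  (forall t : R, t \in `[0, 1] -> alpha (g t) != 0) ->
  [/\ alpha (g 1) = (alpha (g 0) : Cx R) * expc (dlog_integral alpha g)
    & exists P Q : R -> R,
      [/\ {within `[0, 1], continuous Q}, Q 0 = 0,
          Q 1 = complex.Im (dlog_integral alpha g)
        & forall t : R, t \in `[0, 1] ->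
            alpha (g t) = (alpha (g 0) : Cx R) * expc (Complex (P t) (Q t))]].
Proof.
move=> gC1 nz; have [pd qd cdp cdq] := form_path_derive alpha gC1.
have [|P [Q [cQ [P0 Q0] [P1 Q1] pq]]] := polar_lift pd qd cdp cdq.
  by move=> t t01; exact: sqrDc_neq0 (nz t t01).
have I01 : dlog_integral alpha g = Complex (P 1) (Q 1).
  rewrite /dlog_integral /integral01 P1 Q1; congr Complex;
  by apply: eq_Rintegral => t _; rewrite cdiv_eq.
have ReIm (a : Cx R) : Complex (complex.Re a) (complex.Im a) = a by case: a.
have lift (t : R) : t \in `[0, 1] ->
    alpha (g t) = (alpha (g 0) : Cx R) * expc (Complex (P t) (Q t)).
  by move=> t01; have := pq t t01; rewrite !ReIm.
split; first by rewrite I01 lift// in_itv /= ler01 lexx.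
by exists P, Q; split => //; rewrite I01.
Qed.

End LinearForms.

(** * Reflection groups and their hyperplanes *)

Section ReflectionGroup.
Context {R : realType} {n : nat}.
Implicit Types (g w s : 'M[Cx R]_n) (v : 'cV[Cx R]_n).

Lemma reflection_unit s : is_reflection s -> s \in unitmx.
Proof.
move=> [[[//|k] _ sk] _]; move: sk; rewrite exprS -mulmxE => sk.
by case/mulmx1_unit: sk.
Qed.

Lemma generated_by_reflections_group (W : set 'M[Cx R]_n) :
  generated_by_reflections W -> is_GL_subgroup W.
Proof.
move=> [S Srefl WS].
(* [smallest] is an intersection; GL is the member of it that shows the elements of W to be
   invertible. *)
pose GL : set 'M[Cx R]_n := [set g | g \in unitmx].
have GLsub : is_GL_subgroup GL.
  split; first exact: unitmx1.
  - by move=> g gu; split => //; rewrite /GL /= unitmx_inv.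
  - by move=> g h gu hu; rewrite /GL /= unitmx_mul; apply/andP.
have SGL : S `<=` GL by move=> s /Srefl /reflection_unit.
rewrite WS; split.
- by move=> A [[A1 _ _] _].
- move=> g Wg; split; first exact: (Wg GL).
  by move=> A AS; have [[_ Ainv _] _] := AS; have [] := Ainv g (Wg A AS).
- move=> g h Wg Wh A AS; have [[_ _ Amul] _] := AS.
  by apply: Amul; [exact: Wg|exact: Wh].
Qed.

Lemma mem_fixed_space s v : (v \in fixed_space s) = (s *m v == v).
Proof. by rewrite memv_ker lfunE /= mulmxBl mul1mx subr_eq0. Qed.

Lemma mem_lin_img w (U : {vspace 'cV[Cx R]_n}) v : w \in unitmx ->
  (v \in (linfun (mulmx w) @: U)%VS) = (invmx w *m v \in U).
Proof.
move=> wu; apply/idP/idP => [/memv_imgP[u uU ->]|wvU].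
  by rewrite lfunE /= mulKmx.
by apply/memv_imgP; exists (invmx w *m v); rewrite // lfunE /= mulKVmx.
Qed.

Lemma fixed_space_conj w s : w \in unitmx ->
  fixed_space (w *m s *m invmx w) = (linfun (mulmx w) @: fixed_space s)%VS.
Proof.
move=> wu; apply/vspaceP => v; rewrite mem_fixed_space (mem_lin_img _ _ wu) mem_fixed_space.
rewrite -!mulmxA -{2}[v](mulKVmx wu).
by apply/eqP/eqP => [/(can_inj (mulKmx wu))|->].
Qed.

Lemma is_reflection_conj w s : w \in unitmx ->
  is_reflection s -> is_reflection (w *m s *m invmx w).
Proof.
move=> wu [[k k0 sk] ds]; split.
  exists k => //; have -> : (w *m s *m invmx w) ^+ k = w *m s ^+ k *m invmx w.
    elim: (k) => [|j IH]; first by rewrite !expr0 mulmx1 mulmxV.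
    by rewrite !exprS IH -!mulmxE !mulmxA mulmxKV.
  by rewrite sk mulmx1 mulmxV.
rewrite fixed_space_conj // limg_dim_eq //.
have /eqP -> : lker (linfun (mulmx w) : 'Hom('cV[Cx R]_n, 'cV[Cx R]_n)) == 0%VS.
  apply/lker0P => x y; rewrite lfunE /= lfunE /=.
  exact: (can_inj (mulKmx wu)).
exact: capv0.
Qed.

Section Group.
Variable W : {fset 'M[Cx R]_n}.
Hypothesis WG : is_GL_subgroup [set` W].
Local Notation A := (arrangement W).
Local Notation X := (regular_part W).

Lemma group_mx1 : 1%:M \in W. Proof. by have [] := WG. Qed.

Lemma group_unitmx w : w \in W -> w \in unitmx.
Proof. by have [_ Wi _] := WG; move=> /Wi[]. Qed.

Lemma group_invmx w : w \in W -> invmx w \in W.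
Proof. by have [_ Wi _] := WG; move=> /Wi[]. Qed.

Lemma group_mulmx w w' : w \in W -> w' \in W -> w *m w' \in W.
Proof. by have [_ _ Wm] := WG; exact: Wm. Qed.

Lemma group_exprn w k : w \in W -> w ^+ k \in W.
Proof.
move=> wW; elim: k => [|k IH]; first by rewrite expr0 group_mx1.
by rewrite exprS -mulmxE group_mulmx.
Qed.

(** The image of Ker(s - 1) under w is Ker(w s w^-1 - 1), and w s w^-1 is again a reflection of
    W. *)
Lemma arrangement_stable w (H : A) : w \in W ->
  exists K : A, val K = (linfun (mulmx w) @: val H)%VS.
Proof.
move=> wW; have := valP H; rewrite /arrangement => /imfsetP[s /=].
rewrite !inE /= => /andP[sW /asboolP srefl] Hs.
have KA : (linfun (mulmx w) @: val H)%VS \in A.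
  apply/imfsetP; exists (w *m s *m invmx w) => /=.
    rewrite !inE /=; apply/andP; split; first by rewrite !group_mulmx ?group_invmx.
    by apply/asboolP; apply: is_reflection_conj => //; exact: group_unitmx.
  by rewrite fixed_space_conj ?group_unitmx // Hs.
by exists [` KA]%fset.
Qed.

Lemma regular_part_stable w v : w \in W -> X v -> X (w *m v).
Proof.
move=> wW Xv H; apply/negP => wvH; have [K KH] := arrangement_stable H (group_invmx wW).
by have /negP := Xv K; apply; rewrite KH mem_lin_img ?unitmx_inv ?group_unitmx ?invmxK.
Qed.

Lemma W_finite_exponent : exists2 m : nat, (0 < m)%N & forall w, w \in W -> w ^+ m = 1%:M.
Proof.
(* Two of the powers of w with exponents 0 to |W| coincide, which gives an exponent at most |W|; it
   divides |W|!. *)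
have ex1 w : w \in W -> exists2 k, (0 < k <= #|` W|)%N & w ^+ k = 1%:M.
  move=> wW.
  pose f (i : 'I_#|` W|.+1) : W := [` group_exprn i wW]%fset.
  have : ~~ injectiveb f.
    by apply/negP => /injectiveP /leq_card; rewrite card_ord cardfE ltnn.
  move=> /injectivePn[i [j ij fij]].
  have wij : w ^+ i = w ^+ j by move/(congr1 val): fij.
  wlog lt_ij : i j ij fij wij / (i < j)%N.
    move=> H; have [lt|lt|eq] := ltngtP i j.
    - exact: (H i j).
    - by apply: (H j i) => //; rewrite eq_sym.
    - by move: ij; rewrite -val_eqE /= eq eqxx.
  exists (j - i)%N; first by rewrite subn_gt0 lt_ij /= (leq_trans (leq_subr _ _)) // -ltnS.
  have wiu : w ^+ i \in unitmx by apply: group_unitmx; exact: group_exprn.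
  by apply: (can_inj (mulKmx wiu)); rewrite mulmxE -exprD subnKC 1?ltnW // wij mulr1.
exists (#|` W|)`!; first exact: fact_gt0.
move=> w /ex1[k /andP[k0 kW] wk].
have /dvdnP[q ->] : (k %| (#|` W|)`!)%N by apply: dvdn_fact; rewrite k0.
by rewrite mulnC exprM wk expr1n.
Qed.

End Group.
End ReflectionGroup.

(** * Orthogonal vectors of the hyperplanes and their eigenvalues *)

Section Roots.
Context {R : realType} {n : nat} (W : {fset 'M[Cx R]_n}).
Hypothesis WG : is_GL_subgroup [set` W].
Variable phi : {dot 'cV[Cx R]_n for Num.conj}.
Hypothesis phiW : forall w, w \in W ->
     forall u v : 'cV[Cx R]_n, phi (w *m u) (w *m v) = phi u v.
Local Notation A := (arrangement W).
Variable e : A -> 'cV[Cx R]_n.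
Hypothesis e_neq0 : forall H, e H != 0.
Hypothesis e_orth : forall (H : A) (u : 'cV[Cx R]_n), u \in val H -> phi u (e H) = 0.
Variable alpha : A -> 'Hom('cV[Cx R]_n, (Cx R)^o).
Hypothesis alpha_ker : forall H, lker (alpha H) = val H.
Implicit Types (H K : A) (w : 'M[Cx R]_n) (v u : 'cV[Cx R]_n).

(** The condition under which [R0 w] has entry 1 in row K and column H. *)
Definition maps w H K : bool := val K == (linfun (mulmx w) @: val H)%VS.

Lemma alpha_eq0 H v : (alpha H v == 0) = (v \in val H).
Proof. by rewrite -alpha_ker memv_ker. Qed.

Lemma dot_eq0 v : phi v v = 0 -> v = 0.
Proof. by move=> /eqP; rewrite dnorm_eq0 => /eqP. Qed.

Lemma alpha_e_neq0 H : alpha H (e H) != 0.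
Proof.
rewrite alpha_eq0; apply/negP => /e_orth /dot_eq0 /eqP.
by rewrite (negbTE (e_neq0 H)).
Qed.

Lemma decomposition H v : exists2 u, u \in val H &
  v = u + ((alpha H v : Cx R) / alpha H (e H)) *: e H.
Proof.
exists (v - ((alpha H v : Cx R) / alpha H (e H)) *: e H); last by rewrite subrK.
rewrite -alpha_eq0 linearB linearZ /= subr_eq0; apply/eqP; rewrite /GRing.scale /=.
by rewrite mulfVK // alpha_e_neq0.
Qed.

Lemma maps_mem w H K v : w \in W -> maps w H K -> (w *m v \in val K) = (v \in val H).
Proof.
move=> wW /eqP ->; have wu := group_unitmx WG wW.
by rewrite (mem_lin_img _ _ wu) mulKmx.
Qed.

Lemma mapsP w H K : w \in W -> maps w H K <-> forall v, (w *m v \in val K) = (v \in val H).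
Proof.
move=> wW; split=> [wHK v|wHK]; first exact: maps_mem.
apply/eqP/vspaceP => v; have wu := group_unitmx WG wW.
by rewrite (mem_lin_img _ _ wu) -wHK mulKVmx.
Qed.

Lemma maps1 H : maps 1%:M H H.
Proof. by apply/(mapsP _ _ (group_mx1 WG)) => v; rewrite mul1mx. Qed.

Lemma mapsM w w' H K L : w \in W -> w' \in W -> maps w H K -> maps w' K L -> maps (w' *m w)
  H L.
Proof.
move=> wW w'W wHK w'KL; apply/(mapsP _ _ (group_mulmx WG w'W wW)) => v.
by rewrite -mulmxA (maps_mem _ w'W w'KL) (maps_mem _ wW wHK).
Qed.

Lemma mapsV w H K : w \in W -> maps w H K -> maps (invmx w) K H.
Proof.
move=> wW wHK; apply/(mapsP _ _ (group_invmx WG wW)) => v.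
by rewrite -(maps_mem _ wW wHK) mulKVmx // (group_unitmx WG).
Qed.

(** The forms v |-> alpha_K (w v) and alpha_H vanish on the same hyperplane H, hence are
    proportional; the factor is read off at e_H. *)
Lemma maps_alpha w H K v : w \in W -> maps w H K ->
  alpha K (w *m v) = ((alpha K (w *m e H) : Cx R) / alpha H (e H)) * alpha H v.
Proof.
move=> wW wHK; have [u uH {1}->] := decomposition H v.
rewrite mulmxDr linearD /= -scalemxAr linearZ /= /GRing.scale /=.
have /eqP -> : alpha K (w *m u) == 0 by rewrite alpha_eq0 (maps_mem _ wW wHK).
by rewrite add0r mulrAC [RHS]mulrAC; congr (_ / _); exact: mulrC.
Qed.

(** A unitary w that preserves H preserves its orthogonal line: the component of w e_H in H turns
    out to be orthogonal to itself. *)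
Lemma stabilizer_root w H : w \in W -> maps w H H ->
  w *m e H = ((alpha H (w *m e H) : Cx R) / alpha H (e H)) *: e H.
Proof.
move=> wW wH; have [u uH] := decomposition H (w *m e H).
set t := _ / _ => E; rewrite E.
suff -> : u = 0 by rewrite add0r.
apply: dot_eq0; rewrite {2}(_ : u = w *m e H - t *: e H); last first.
  by rewrite E addrK.
rewrite linearBr linearZr_LR /= e_orth // mulr0 subr0.
rewrite -[u in phi u](mulKVmx (group_unitmx WG wW)) phiW // e_orth //.
by rewrite (maps_mem _ (group_invmx WG wW) (mapsV wW wH)).
Qed.

(** H is the orthogonal complement of e_H, and the unitary w carries it to the complement of zeta
    e_H, where zeta is nonzero because w is invertible. *)
Lemma eigen_maps w H (zeta : Cx R) : w \in W -> w *m e H = zeta *: e H -> maps w H H.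
Proof.
move=> wW we; apply/(mapsP _ _ wW).
have perp v : (v \in val H) = (phi v (e H) == 0).
  apply/idP/eqP => [/e_orth //|]; have [u uH ->] := decomposition H v.
  rewrite linearDl /= e_orth // add0r linearZl_LR /= => /eqP.
  rewrite scaler_eq0 dnorm_eq0 (negbTE (e_neq0 H)) orbF => /eqP->.
  by rewrite scale0r addr0.
have zeta0 : zeta != 0.
  apply/eqP => z0; have := e_neq0 H; rewrite -[e H](mulKmx (group_unitmx WG wW)) we z0.
  by rewrite scale0r mulmx0 eqxx.
move=> v; rewrite !perp -(phiW wW v) we linearZr_LR /= scaler_eq0.
by rewrite conjC_eq0 (negbTE zeta0).
Qed.

Lemma eigenvalue_root_of_unity : exists2 m : nat, (0 < m)%N &
  forall w H (zeta : Cx R), w \in W -> w *m e H = zeta *: e H -> zeta ^+ m = 1.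
Proof.
have [m m0 Wm] := W_finite_exponent WG; exists m => // w H zeta wW we.
have wk k : w ^+ k *m e H = zeta ^+ k *: e H.
  elim: k => [|k IH]; first by rewrite !expr0 mul1mx scale1r.
  by rewrite !exprS -mulmxE -mulmxA IH -scalemxAr we scalerA mulrC.
have := wk m; rewrite Wm // mul1mx => /eqP; rewrite -subr_eq0 -{1}[e H]scale1r -scalerBl.
by rewrite scaler_eq0 (negbTE (e_neq0 H)) orbF subr_eq0 => /eqP.
Qed.

Lemma kappa_exists : exists k, is_minimum (kappa_set e) k.
Proof.
have [m m0 mP] := eigenvalue_root_of_unity.
have exk : exists k, `[< kappa_set e k >] by exists m; apply/asboolP; split.
case: (ex_minnP exk) => k /asboolP kP kmin; exists k; split=> // j jP.
by apply: kmin; apply/asboolP.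
Qed.

End Roots.

(** * Homotopy invariance *)

Section Grid.

(** Compactness in near-covering form, applied to the filter of small d > 0. It serves to choose a
    mesh that is fine enough for all cells of a grid at once. *)
Lemma lebesgue_number (R : realType) (T : pseudoMetricType R) (K : set T)
    (P : T -> T -> Prop) : compact K ->
  (forall p0, K p0 -> exists2 U, nbhs p0 U &
     forall p q, U p -> U q -> K p -> K q -> P p q) ->
  exists2 d : R, 0 < d & forall p q, K p -> K q -> ball p d q -> P p q.
Proof.
move=> /compact_near_coveringP cK locP.
have /= := cK R (0 : R)^'+ (fun d p => K p -> forall q, K q -> ball p d q -> P p q) _.
case.
- move=> p0 Kp0; have [U /nbhs_ballP[e /= e0 eU] UP] := locP p0 Kp0.
  (* p stays within e/2 of p0 and q within d < e/2 of p, so both lie in the e-ball around p0. *)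
  have e20 : 0 < e / 2 by rewrite divr_gt0.
  exists (ball p0 (e / 2), [set d | d < e / 2]) => /=.
    by split; [exact: nbhsx_ballx|exact: nbhs_right_lt].
  move=> [p d] /= [p0p de] Kp q Kq pq; apply: UP => //; apply: eU.
    by apply: le_ball p0p; lra.
  rewrite (_ : e = e / 2 + e / 2); last by field.
  by apply: ball_triangle p0p _; apply: le_ball pq; exact: ltW.
- move=> d0 d00 dP.
  exists (d0 / 2); first by rewrite divr_gt0.
  move=> p q Kp Kq pq; apply: (dP (d0 / 2)) => //=; last by rewrite divr_gt0.
  rewrite sub0r normrN ger0_norm; last by rewrite divr_ge0 // ltW.
  by move: d00 => /=; lra.
Qed.

(* The grid version of homotopy lifting: row by row, the lifts of neighbouring
   points are matched by closeness, and separation of the fibres forces the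
   matched rows to be again discrete paths with the same endpoints. *)
Lemma grid_monodromy (E : Type) (close : E -> E -> Prop)
    (fib : nat -> nat -> E -> Prop) (N : nat) (a b : nat -> E) :
  (forall x, close x x) -> (forall x y, close x y -> close y x) ->
  (forall i j x y x1 x2 x3, (i <= N)%N -> (j <= N)%N -> fib i j x -> fib i j y ->
     close x x1 -> close x1 x2 -> close x2 x3 -> close x3 y -> x = y) ->
  (forall i j x, (i < N)%N -> (j <= N)%N -> fib i j x ->
     exists2 y, fib i.+1 j y & close x y) ->
  (forall i j x, (i <= N)%N -> (j < N)%N -> fib i j x ->
     exists2 y, fib i j.+1 y & close x y) ->
  (forall j, (j <= N)%N -> fib 0 j (a j)) ->
  (forall j, (j <= N)%N -> fib N j (b j)) ->
  (forall j, (j < N)%N -> close (a j) (a j.+1)) ->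
  (forall j, (j < N)%N -> close (b j) (b j.+1)) ->
  (forall i, (i <= N)%N -> fib i 0 (a 0) /\ fib i N (a N)) ->
  a 0 = b 0 -> a N = b N.
Proof.
move=> crefl csym sep vstep hstep fa fb ca cb ends a0b0.
have row i : (i <= N)%N -> exists c : nat -> E,
    [/\ forall j, (j <= N)%N -> fib i j (c j), forall j, (j < N)%N -> close (c j) (c j.+1),
        c 0 = a 0 & c N = a N].
  elim: i => [_|i IH iN]; first by exists a; split.
  have [c [fc cc c0 cN]] := IH (ltnW iN).
  have /choice[d dP] : forall j, exists y, (j <= N)%N -> fib i.+1 j y /\ close (c j) y.
    move=> j; have [jN|jN] := leqP j N; last by exists (c j).
    by have [y fy cy] := vstep i j (c j) iN jN (fc j jN); exists y.
  (* At both ends of the row the old lift also lies over the new point, so separation makes the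
     matched point equal to it. *)
  have endE j : (j <= N)%N -> fib i.+1 j (c j) -> d j = c j.
    move=> jN fj; have [fd cd] := dP j jN.
    exact: (sep i.+1 j _ _ (c j) (c j) (c j)) (csym _ _ cd) (crefl _) (crefl _) (crefl _).
  exists d; split.
  - by move=> j jN; have [] := dP j jN.
  - move=> j jN; have [fd cd] := dP j (ltnW jN).
    have [fd1 cd1] := dP j.+1 jN.
    have [y fy cy] := hstep i.+1 j (d j) iN jN fd.
    (* The chain d(j+1), c(j+1), c(j), d(j), y has four close steps, as many as separation
       admits. *)
    rewrite (sep i.+1 j.+1 (d j.+1) y (c j.+1) (c j) (d j)) //.
    + exact: csym.
    + by apply: csym; exact: cc.
  - by rewrite endE // c0; have [] := ends _ iN.
  - by rewrite endE // cN; have [] := ends _ iN.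
have [c [fc cc c0 cN]] := row N (leqnn N).
suff cb' j : (j <= N)%N -> c j = b j by rewrite -cN cb'.
elim: j => [_|j IH jN]; first by rewrite c0.
(* The last row and b lie over the same points; the chain c(j+1), c(j) = b(j), b(j+1) is padded with
   reflexive steps. *)
apply: (sep N j.+1 _ _ (c j) (b j) (b j.+1)) => //; [exact: fc|exact: fb| | |exact: cb].
- by apply: csym; exact: cc.
- by rewrite IH // ltnW.
Qed.

End Grid.

(** * Arguments of complex numbers *)

Section Args.
Context {R : realType}.
Implicit Types (a b : Cx R) (s t : R).

(** A relation rather than a function, so that t may be any real determination and can be followed
    continuously past 2 pi. *)
Definition has_arg a t : Prop :=
  exists2 r : R, 0 < r & a = Complex (r * cos t) (r * sin t).

Lemma has_arg_expc (x y : R) : has_arg (expc (Complex x y)) y.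
Proof. by exists (expR x); [exact: expR_gt0|]. Qed.

Lemma has_argM a b s t : has_arg a s -> has_arg b t -> has_arg (a * b) (s + t).
Proof.
move=> [r r0 ->] [r' r'0 ->]; exists (r * r'); first exact: mulr_gt0.
rewrite cosD sinD; apply/eqP; rewrite eq_complex /=.
by apply/andP; split; apply/eqP; ring.
Qed.

Lemma has_argV a t : has_arg a t -> has_arg a^-1 (- t).
Proof.
move=> [r r0 ->]; exists r^-1; first by rewrite invr_gt0.
have r1 : r * r^-1 = 1 by rewrite divff // gt_eqF.
have cs := cos2Dsin2 t.
suff E : Complex (r * cos t) (r * sin t) * Complex (r^-1 * cos (- t)) (r^-1 * sin (- t)) =
  1 :> Cx R.
  have nz : Complex (r * cos t) (r * sin t) != 0 :> Cx R.
    by apply/eqP => a0; move/eqP: E; rewrite a0 mul0r eq_sym oner_eq0.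
  by apply: (mulfI nz); rewrite E divff.
rewrite cosN sinN; apply/eqP; rewrite eq_complex /=; apply/andP; split; apply/eqP.
  transitivity ((r * r^-1) * (cos t ^+ 2 + sin t ^+ 2)); last by rewrite r1 cs mulr1.
  by ring.
by ring.
Qed.

(** The moduli agree, so cos (s - t) = 1; then the half-angle |s - t| / 2, which lies in [0, pi),
    has sine 0. *)
Lemma has_arg_inj a s t : has_arg a s -> has_arg a t -> `|s - t| < pi *+ 2 -> s = t.
Proof.
move=> [r r0 ->] [r' r'0 [cE sE]] st.
have cs := cos2Dsin2 s; have ct := cos2Dsin2 t.
have rr' : r = r'.
  have r2 : r ^+ 2 = r' ^+ 2.
    rewrite -[LHS]mulr1 -[RHS]mulr1 -{1}cs -ct !mulrDr -!exprMn.
    by rewrite cE sE.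
  move/eqP: r2; rewrite -subr_eq0 subr_sqr mulf_eq0 subr_eq0 => /orP[/eqP //|/eqP]; lra.
rewrite -rr' in cE sE.
have {}cE := mulfI (lt0r_neq0 r0) cE; have {}sE := mulfI (lt0r_neq0 r0) sE.
have c1 : cos (s - t) = 1 by rewrite cosB cE sE -!expr2.
pose y := `|s - t| / 2.
have y0 : 0 <= y by rewrite divr_ge0.
have cy : cos (y *+ 2) = 1.
  rewrite (_ : y *+ 2 = `|s - t|); last by rewrite /y mulr2n; field.
  by have [st0|st0] := leP 0 (s - t); [rewrite ger0_norm|rewrite ltr0_norm // cosN].
have sy : sin y = 0.
  apply/eqP; rewrite -sqrf_eq0; apply/eqP.
  by move: cy; rewrite mulr2n cosD -!expr2; have := cos2Dsin2 y; lra.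
move: y0; rewrite le_eqVlt => /predU1P[y0|y0].
  move: y0; rewrite /y => /eqP; rewrite eq_sym mulf_eq0 invr_eq0 pnatr_eq0 orbF normr_eq0.
  by rewrite subr_eq0 => /eqP.
have : 0 < sin y by apply: sin_gt0_pi; rewrite y0 /= /y; move: st; rewrite mulr2n; lra.
by rewrite sy ltxx.
Qed.

(** The bound places a in the sector |Im a| < Re a, where atan (Im a / Re a) is an argument. Two
    such arguments add up to the pi / 2 of [local_matching]. *)
Lemma has_arg_near1 a : absc1 (a - 1) < 2^-1 -> exists2 t, has_arg a t & `|t| < pi / 4.
Proof.
case: a => x y; rewrite /absc1 /= subr0 => xy.
have [x1 xgt] : `|x - 1| + `|y| < 2^-1 /\ 0 < x.
  by split=> //; have := ler_norm (1 - x); rewrite distrC; have := normr_ge0 y; lra.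
have yx : `|y / x| < 1.
  rewrite normrM normfV (gtr0_norm xgt) ltr_pdivrMr // mul1r.
  by have := ler_norm (1 - x); rewrite distrC; lra.
exists (atan (y / x)).
  have [/andP[a1 a2] ta] := atan_def (y / x).
  set T := atan (y / x) in a1 a2 ta *.
  have c0 : 0 < cos T by apply: cos_gt0_pihalf; rewrite a1 a2.
  exists (x / cos T); first by rewrite divr_gt0.
  have -> : sin T = y / x * cos T.
    by rewrite -[in RHS]ta /tan mulfVK // gt_eqF.
  have x0 := lt0r_neq0 xgt; have cn0 := lt0r_neq0 c0.
  by congr Complex; field; rewrite ?x0 ?cn0.
move: yx; rewrite !ltr_norml => /andP[y1 y2].
by rewrite -atan1 -atanN; apply/andP; split; apply: lt_atan.
Qed.

End Args.

Section VectorNorm.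
Context {R : realType} {n : nat}.
Implicit Types (x y v : 'cV[Cx R]_n) (w : 'M[Cx R]_n).

Definition nrm v : R := \sum_i absc1 (v i 0).

Lemma nrmD x y : nrm (x + y) <= nrm x + nrm y.
Proof.
rewrite /nrm -big_split /=; apply: ler_sum => i _; rewrite mxE; exact: absc1D.
Qed.

Lemma nrmB_sym x y : nrm (x - y) = nrm (y - x).
Proof.
by rewrite /nrm; apply: eq_bigr => i _; rewrite -absc1N !mxE opprB.
Qed.

Lemma nrm_dist3 x y z : nrm (x - z) <= nrm (x - y) + nrm (y - z).
Proof. by rewrite -[x - z](subrKA y); exact: nrmD. Qed.

Lemma absc1_ge0 (a : Cx R) : 0 <= absc1 a.
Proof. by rewrite addr_ge0. Qed.

Lemma nrm_ge0 v : 0 <= nrm v.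
Proof. by apply: sumr_ge0 => i _; exact: absc1_ge0. Qed.

Lemma nrm0 : nrm 0 = 0.
Proof. by rewrite /nrm big1 // => i _; rewrite mxE /absc1 /= normr0 addr0. Qed.

Lemma nrm_eq0 v : nrm v = 0 -> v = 0.
Proof.
move=> /eqP; rewrite psumr_eq0 => [/allP v0|i _]; last exact: absc1_ge0.
apply/matrixP => i j; rewrite ord1 mxE; apply: absc1_eq0; apply/eqP.
by apply: v0; rewrite mem_index_enum.
Qed.

Lemma absc1_sum (I : finType) (F : I -> Cx R) : absc1 (\sum_i F i) <= \sum_i absc1 (F i).
Proof.
elim/big_ind2 : _ => //; first by rewrite /absc1 /= normr0 addr0.
by move=> a b c d ab cd; apply: le_trans (absc1D _ _) _; exact: lerD.
Qed.

Lemma nbhs_nrm x (e : R) : 0 < e -> \forall y \near x, nrm (x - y) < e.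
Proof.
(* With n + 1 in place of n, the sum of the n bounds stays strictly below e, also for n = 0. *)
move=> e0; have e'0 : 0 < e / n.+1%:R by rewrite divr_gt0.
have : \forall y \near x, forall i, absc1 (x i 0 - (y : 'cV[Cx R]_n) i 0) < e / n.+1%:R.
  apply: (@filter_forall _ _ (fun i y => absc1 (x i 0 - y i 0) < e / n.+1%:R) (nbhs x)).
  move=> i.
  exact: (@coord_continuous _ _ _ i 0 x _ (nbhs_absc1 (x i 0) e'0)).
apply: filterS => y xy.
apply: (@le_lt_trans _ _ (\sum_(i < n) e / n.+1%:R)).
  by apply: ler_sum => i _; rewrite !mxE; exact: ltW.
rewrite sumr_const card_ord -[X in X < _]mulr_natr -mulrA gtr_pMr // mulrC ltr_pdivrMr //
  mul1r ltr_nat.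
exact: ltnSn.
Qed.

Lemma cvg_nrm T (F : set_system T) (f : T -> 'cV[Cx R]_n) x : Filter F ->
  (forall e : R, 0 < e -> \forall t \near F, nrm (x - f t) < e) -> f @ F --> x.
Proof.
move=> FF fx; apply: cvg_coord => i j; apply: cvg_absc1 => e e0.
apply: filterS (fx e e0) => t; apply: le_lt_trans.
rewrite ord1 /nrm (bigD1 i) //= !mxE lerDl; apply: sumr_ge0 => k _; exact: absc1_ge0.
Qed.

Lemma linear_form_bound (b : 'Hom('cV[Cx R]_n, (Cx R)^o)) :
  exists2 C : R, 0 < C & forall v, absc1 (b v) <= C * nrm v.
Proof.
(* The summand 1 keeps the constant positive for the zero form, so that it can be divided by. *)
exists (1 + \sum_i absc1 (b (delta_mx i 0))).
  by rewrite ltr_pwDl // sumr_ge0 // => i _; exact: absc1_ge0.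
move=> v; rewrite linear_form_sum; apply: le_trans (absc1_sum _) _.
rewrite mulr_sumr; apply: ler_sum => i _; apply: le_trans (absc1M _ _) _.
rewrite mulrC ler_wpM2r ?absc1_ge0 // (bigD1 i) //= addrCA lerDl.
by rewrite addr_ge0 // sumr_ge0 // => k _; exact: absc1_ge0.
Qed.

Lemma mulmx_bound w : exists2 C : R, 0 < C & forall v, nrm (w *m v) <= C * nrm v.
Proof.
exists (1 + \sum_i \sum_j absc1 (w i j)).
  by rewrite ltr_pwDl // sumr_ge0 // => i _; rewrite sumr_ge0 // => j _; exact: absc1_ge0.
move=> v; rewrite mulrDl mul1r; apply: ler_wpDl; first exact: nrm_ge0.
rewrite mulr_suml; apply: ler_sum => i _; rewrite mxE; apply: le_trans (absc1_sum _) _.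
rewrite mulr_suml; apply: ler_sum => j _; apply: le_trans (absc1M _ _) _.
rewrite ler_wpM2l ?absc1_ge0 // /nrm (bigD1 j) //= lerDl.
by rewrite sumr_ge0 // => k _; exact: absc1_ge0.
Qed.

Lemma nbhs_mulmx w x (e : R) : 0 < e -> \forall y \near x, nrm (w *m y - w *m x) < e.
Proof.
move=> e0; have [C C0 wC] := mulmx_bound w.
have eC : 0 < e / C by rewrite divr_gt0.
apply: filterS (nbhs_nrm x eC) => y xy.
rewrite -mulmxBr; apply: le_lt_trans (wC _) _.
by rewrite nrmB_sym mulrC -ltr_pdivlMr.
Qed.

Lemma mulmx_continuous w : continuous (mulmx w : 'cV[Cx R]_n -> 'cV[Cx R]_n).
Proof.
move=> x; apply: (@cvg_nrm _ (nbhs x)) => e e0.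
by apply: filterS (nbhs_mulmx w x e0) => y; rewrite nrmB_sym.
Qed.

(** Together with [has_arg_near1] this controls the change of arg b (w y) near x without a branch of
    the argument. *)
Lemma nbhs_ratio (b : 'Hom('cV[Cx R]_n, (Cx R)^o)) w x (e : R) : 0 < e ->
  b (w *m x) != 0 -> \forall y \near x, absc1 ((b (w *m y) : Cx R) / b (w *m x) - 1) < e.
Proof.
move=> e0 bx; have [C C0 bC] := linear_form_bound b.
pose D := 1 + absc1 (b (w *m x) : Cx R)^-1.
have D0 : 0 < D by rewrite ltr_pwDl // absc1_ge0.
have eC : 0 < e / (C * D) by rewrite divr_gt0 // mulr_gt0.
apply: filterS (nbhs_mulmx w x eC) => y xy.
rewrite -[X in _ - X](divff bx) -mulrBl -linearB /=.
apply: le_lt_trans (absc1M _ _) _.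
apply: (@le_lt_trans _ _ ((C * nrm (w *m y - w *m x)) * D)).
  by apply: ler_pM; rewrite ?absc1_ge0 // /D lerDr.
by rewrite mulrAC mulrC -ltr_pdivlMr // mulr_gt0.
Qed.

End VectorNorm.

(** * Topology of the orbit space *)

Section Quotient.
Context {R : realType} {n : nat} (W : {fset 'M[Cx R]_n}).
Hypothesis WG : is_GL_subgroup [set` W].
Local Notation X := (regular_part W).
Variable z : X.
Local Notation proj := (orbit_proj W z).
Implicit Types (x y v : 'cV[Cx R]_n) (w : 'M[Cx R]_n).

Lemma regular_insubd x : X x -> val (insubd z x) = x.
Proof. by move=> Xx; rewrite insubdK //; exact/mem_set. Qed.

Lemma orbit_projP x y : X x -> X y ->
  proj x = proj y <-> exists2 w, w \in W & y = w *m x.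
Proof.
move=> Xx Xy; rewrite /orbit_proj; split.
  move=> /eqquotP; rewrite /= /same_orbit !regular_insubd // => /eqP xy.
  have : y \in orbit_of W y.
    by apply/imfsetP; exists 1%:M; [exact: (group_mx1 WG)|rewrite mul1mx].
  by rewrite -xy => /imfsetP[w /= wW ->]; exists w.
move=> [w wW yE]; apply/eqquotP; rewrite /= /same_orbit !regular_insubd //.
apply/eqP/fsetP => u; apply/imfsetP/imfsetP => -[g /= gW ->].
  exists (g *m invmx w); first by rewrite /= (group_mulmx WG) ?(group_invmx WG).
  by rewrite yE mulmxA mulmxKV // (group_unitmx WG).
exists (g *m w); first by rewrite /= (group_mulmx WG).
by rewrite yE mulmxA.
Qed.

Lemma proj_mul w x : w \in W -> X x -> proj (w *m x) = proj x.
Proof.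
move=> wW Xx; apply/esym/orbit_projP => //; first exact: regular_part_stable.
by exists w.
Qed.

Lemma proj_surj (y : orbit_space W X) : exists2 x, X x & proj x = y.
Proof.
exists (val (repr (y : {eq_quot same_orbit_equiv W X}%qT))); first exact/set_mem/valP.
by rewrite /orbit_proj valKd reprK.
Qed.

(** Unfolds the quotient topology and the subspace topology of X at once, so that later arguments
    handle only open sets of the vector space. *)
Lemma open_orbitP (O : set (orbit_space W X)) :
  open O <-> exists2 U : set 'cV[Cx R]_n, open U & forall x, X x -> O (proj x) <-> U x.
Proof.
split.
  move=> [U oU UO]; exists U => // x Xx.
  have -> : U x = (set_val @^-1` U) (insubd z x) by rewrite /= set_valE regular_insubd.
  by rewrite UO.
move=> [U oU UO]; exists U => //; apply/seteqP; split=> u /=.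
  rewrite set_valE => /(UO _ (set_mem (valP u))).
  by rewrite /orbit_proj valKd.
move=> Ou; rewrite set_valE; apply/(UO _ (set_mem (valP u))).
by rewrite /orbit_proj valKd.
Qed.

Lemma proj_continuous T (F : set_system T) (f : T -> 'cV[Cx R]_n) x : Filter F ->
  X x -> f @ F --> x -> (\forall t \near F, X (f t)) -> (proj \o f) @ F --> proj x.
Proof.
move=> FF Xx fx FX O; rewrite nbhsE => -[B [/open_orbitP[U oU UB] Bx] BO].
have Ux : U x by apply/UB.
have : nbhs x U by exact: open_nbhs_nbhs.
move=> /fx fU; apply: (filterS _ (filterI FX fU)) => t [Xt Ut].
apply: (BO _); exact: (UB _ Xt).2 Ut.
Qed.

(** The saturation of an open set is a union of its preimages under elements of W, hence open. This
    is what lifts nearby orbits to points near a given lift. *)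
Lemma orbit_proj_open x (Q : set 'cV[Cx R]_n) : X x -> nbhs x Q ->
  nbhs (proj x) [set y | exists x', [/\ X x', Q x' & proj x' = y]].
Proof.
move=> Xx xQ; have [U [oU Ux] UQ] : exists2 U, open_nbhs x U & U `<=` Q.
  by move: xQ; rewrite nbhsE.
pose B := [set y | exists x', [/\ X x', U x' & proj x' = y]].
apply: (@filterS _ _ _ B).
  by move=> y [x' [Xx' Ux' x'y]]; exists x'; split => //; exact: UQ.
apply: open_nbhs_nbhs; split; last by exists x.
apply/open_orbitP; exists (\bigcup_(w in [set` W]) (mulmx w @^-1` U)).
  apply: bigcup_open => w _; apply: open_comp => // y _; exact: mulmx_continuous.
move=> y Xy; split=> [[x' [Xx' Ux' /esym/(orbit_projP Xy Xx')[w wW x'E]]]|].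
  by exists w => //=; rewrite -x'E.
move=> [w /= wW Uwy]; exists (w *m y); split => //; first exact: regular_part_stable.
exact: proj_mul.
Qed.

End Quotient.

Section Monodromy.
Context {R : realType} {n : nat} (W : {fset 'M[Cx R]_n}).
Hypothesis WG : is_GL_subgroup [set` W].
Local Notation X := (regular_part W).
Hypothesis Wfree : acts_freely W X.
Variable z : X.
Local Notation proj := (orbit_proj W z).
Variable alpha : 'Hom('cV[Cx R]_n, (Cx R)^o).
Hypothesis alphaX : forall x, X x -> alpha x != 0.
Local Notation arg_at x t := (has_arg ((alpha x : Cx R) / alpha (val z)) t).
Implicit Types (x y v : 'cV[Cx R]_n) (w : 'M[Cx R]_n).

(** Monotonicity lets local thresholds be lowered to a common one, found by compactness along the
    filter of small positive reals. *)
Lemma compact_uniform (T : topologicalType) (K : set T) (P : R -> T -> Prop) :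
  compact K -> (forall e e' p, e' <= e -> P e p -> P e' p) ->
  (forall p0, K p0 -> exists U (e : R), [/\ nbhs p0 U, 0 < e & forall p, U p -> K p -> P e
    p]) ->
  exists2 e : R, 0 < e & forall p, K p -> P e p.
Proof.
move=> /compact_near_coveringP cK mono locP.
have /= := cK R (0 : R)^'+ (fun d p => K p -> P d p) _.
case.
- move=> p0 Kp0; have [U [e [Up0 e0 UP]]] := locP p0 Kp0.
  exists (U, [set d | d < e]) => /=; first by split => //; exact: nbhs_right_lt.
  by move=> [p d] /= [Up de] Kp; apply: mono (ltW de) _; exact: UP.
- move=> d0 d00 dP; exists (d0 / 2); first by rewrite divr_gt0.
  move=> p Kp; apply: (dP (d0 / 2)) => //=; last by rewrite divr_gt0.
  rewrite sub0r normrN ger0_norm; last by rewrite divr_ge0 // ltW.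
  by move: d00 => /=; lra.
Qed.

(** Freeness makes the points w x distinct, and their finitely many distances have a positive lower
    bound. *)
Lemma free_gap x : X x -> exists2 e : R, 0 < e &
  forall u v : W, val u != val v -> e <= nrm (val u *m x - val v *m x).
Proof.
move=> Xx.
have gap (u v : W) : val u != val v -> 0 < nrm (val u *m x - val v *m x).
  move=> uv; rewrite lt_def nrm_ge0 andbT; apply: contra uv => /eqP/nrm_eq0/eqP.
  rewrite subr_eq0 => /eqP E; have uu := group_unitmx WG (valP u).
  have vuW : invmx (val v) *m val u \in W.
    by rewrite (group_mulmx WG) ?(group_invmx WG) ?(valP u) ?(valP v).
  have vu1 : invmx (val v) *m val u = 1%:M.
    by apply: (Wfree vuW Xx); rewrite -mulmxA E mulKmx // (group_unitmx WG (valP v)).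
  by rewrite -[val u](mulKVmx (group_unitmx WG (valP v))) vu1 mulmx1.
have : \forall e \near (0 : R)^'+, forall uv : W * W, val uv.1 != val uv.2 ->
    e <= nrm (val uv.1 *m x - val uv.2 *m x).
  apply: filter_forall => -[u v] /=.
  have [uv|uv] := eqVneq (val u) (val v); first exact: nearW.
  by apply: filterS (nbhs_right_le (gap u v uv)) => e.
move=> /(filterI (nbhs_right_gt (0 : R))) /filter_ex[e /= [e0 eP]].
by exists e => // u v uv; exact: (eP (u, v)).
Qed.

Lemma gap_contradiction (g a b c d f : R) : c <= d + f -> a <= b + c ->
  d < g / 3 -> f < g / 3 -> b < g / 3 -> ~ (g <= a).
Proof. by move=> ? ? ? ? ? ?; lra. Qed.

Section Homotopy.
Variables (T : topologicalType) (K : set T) (F : T -> orbit_space W X).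
Hypothesis cF : {within K, continuous F}.

(** Openness of the projection at x0, pulled back along the continuous F. *)
Lemma local_lift p0 x0 (Q : set 'cV[Cx R]_n) : K p0 -> X x0 -> proj x0 = F p0 -> nbhs x0 Q ->
  \forall p \near p0, K p -> exists x, [/\ X x, Q x & proj x = F p].
Proof.
move=> Kp0 Xx0 xF x0Q; have := orbit_proj_open WG z Xx0 x0Q; rewrite xF => sheet.
have /subspace_continuousP/(_ p0 Kp0 _ sheet) := cF.
rewrite /fmap /= withinE /= => -[V pV E]; apply: filterS pV => p Vp Kp.
by have : (V `&` K) p by []; rewrite -E => -[].
Qed.

(** Near p0, any two lifts of F p are u x1 and v x1 with x1 close to x0. If u and v differ, u x0 and
    v x0 are at distance at least g and each moves by less than g / 3, so more than g / 3
    remains. *)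
Lemma uniform_separation : compact K -> exists2 e : R, 0 < e &
  forall p, K p -> forall x y, X x -> X y -> proj x = F p -> proj y = F p ->
    nrm (x - y) < e -> x = y.
Proof.
move=> cK; apply: compact_uniform => //.
  by move=> e e' p e'e H x y Xx Xy xF yF xy; apply: H => //; exact: lt_le_trans e'e.
move=> p0 Kp0; have [x0 Xx0 x0F] := proj_surj z (F p0).
have [g g0 gP] := free_gap Xx0.
have g30 : 0 < g / 3 by rewrite divr_gt0.
have Q0 : \forall x \near x0, forall u : W, nrm (val u *m x - val u *m x0) < g / 3.
  apply: (@filter_forall _ _ (fun (u : W) x =>
    nrm (val u *m x - val u *m x0) < g / 3) (nbhs x0)).
  by move=> u; exact: nbhs_mulmx.
have := local_lift Kp0 Xx0 x0F Q0; set U := fun p => _ => pU.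
exists U, (g / 3); split => // p Up Kp x y Xx Xy xF yF xy.
have [x1 [Xx1 Qx1 x1F]] := Up Kp.
have [u uW xE] : exists2 u, u \in W & x = u *m x1 by apply/(orbit_projP WG z Xx1 Xx);
  rewrite x1F xF.
have [v vW yE] : exists2 v, v \in W & y = v *m x1 by apply/(orbit_projP WG z Xx1 Xy);
  rewrite x1F yF.
have [uv|uv] := eqVneq u v; first by rewrite xE yE uv.
have := gP [` uW]%fset [` vW]%fset uv; have := Qx1 [` uW]%fset; have := Qx1 [` vW]%fset.
rewrite /= -xE -yE (nrmB_sym x).
have := nrm_dist3 (u *m x0) x (v *m x0); have := nrm_dist3 x y (v *m x0).
by move=> t1 t2 h1 h2 h3; have := gap_contradiction t1 t2 xy h1 h2 h3.
Qed.

(** For x = u x1 over p, with x1 near x0, the match is u y1 with the same u and y1 near x0 over q.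
    The argument is corrected by those of alpha (u x1) and alpha (u y1) relative to alpha (u x0),
    each below pi / 4. *)
Lemma local_matching (e : R) p0 : 0 < e -> K p0 -> exists2 U, nbhs p0 U &
  forall p q, U p -> U q -> K p -> K q ->
    forall x (s : R), X x -> proj x = F p -> arg_at x s ->
    exists y (t : R), [/\ X y, proj y = F q, arg_at y t, nrm (x - y) < e & `|s - t| < pi / 2].
Proof.
move=> e0 Kp0; have [x0 Xx0 x0F] := proj_surj z (F p0).
have e20 : 0 < e / 2 by rewrite divr_gt0.
have ux0 (u : W) : alpha (val u *m x0) != 0.
  by apply: alphaX; apply: (regular_part_stable WG) => //; exact: valP.
have Q0 : \forall x \near x0, forall u : W, nrm (val u *m x - val u *m x0) < e / 2 /\
    absc1 ((alpha (val u *m x) : Cx R) / alpha (val u *m x0) - 1) < 2^-1.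
  apply: (@filter_forall _ _ (fun (u : W) x => nrm (val u *m x - val u *m x0) < e / 2 /\
    absc1 ((alpha (val u *m x) : Cx R) / alpha (val u *m x0) - 1) < 2^-1) (nbhs x0)).
  by move=> u; apply: filterI; [exact: nbhs_mulmx|apply: nbhs_ratio].
have := local_lift Kp0 Xx0 x0F Q0; set U := fun p => _ => pU.
exists U => // p q Up Uq Kp Kq x s Xx xF sx.
have [x1 [Xx1 Qx1 x1F]] := Up Kp; have [y1 [Xy1 Qy1 y1F]] := Uq Kq.
have [u uW xE] : exists2 u, u \in W & x = u *m x1 by apply/(orbit_projP WG z Xx1 Xx);
  rewrite x1F xF.
have Xy : X (u *m y1) by exact: (regular_part_stable WG).
have [/= nx /has_arg_near1[a ha a4]] := Qx1 [` uW]%fset.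
have [/= ny /has_arg_near1[b hb b4]] := Qy1 [` uW]%fset.
exists (u *m y1), (s - a + b); split => //.
- by rewrite (proj_mul WG).
- have nz0 := alphaX (set_mem (valP z)); have nx1 := alphaX Xx; have u0 := ux0 [` uW]%fset.
  have cancel (a1 b1 c1 d1 : Cx R) : a1 != 0 -> c1 != 0 -> d1 != 0 ->
      a1 / d1 * (a1 / c1)^-1 * (b1 / c1) = b1 / d1.
    by move=> ? ? ?; field; apply/and3P.
  by have := has_argM (has_argM sx (has_argV ha)) hb; rewrite /= -xE cancel.
- rewrite xE; have := nrm_dist3 (u *m x1) (u *m x0) (u *m y1).
  move: nx ny; rewrite /= (nrmB_sym (u *m y1)) => nx ny t1; lra.
- move: a4 b4; rewrite !ltr_norml => /andP[a1 a2] /andP[b1 b2].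
  by apply/andP; split; lra.
Qed.

End Homotopy.

End Monodromy.

Section HomotopyInvariance.
Context {R : realType} {n : nat} (W : {fset 'M[Cx R]_n}).
Hypothesis WG : is_GL_subgroup [set` W].
Local Notation X := (regular_part W).
Hypothesis Wfree : acts_freely W X.
Variable z : X.
Local Notation proj := (orbit_proj W z).
Variable alpha : 'Hom('cV[Cx R]_n, (Cx R)^o).
Hypothesis alphaX : forall x, X x -> alpha x != 0.
Local Notation arg_at x t := (has_arg ((alpha x : Cx R) / alpha (val z)) t).

Definition nrm_continuous01 (g : R -> 'cV[Cx R]_n) :=
  forall t0 : R, t0 \in `[0, 1] -> forall e : R, 0 < e ->
    \forall t \near t0, nrm (g t0 - g t) < e.

Lemma uniform_small_steps (g : R -> 'cV[Cx R]_n) (theta : R -> R) (e : R) : 0 < e ->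
  nrm_continuous01 g -> {within `[0, 1], continuous theta} ->
  exists2 d : R, 0 < d & forall s t : R, s \in `[0, 1] -> t \in `[0, 1] -> ball s d t ->
    nrm (g s - g t) < e /\ `|theta s - theta t| < pi / 2.
Proof.
move=> e0 cg ctheta.
have [|d d0 dP] := @lebesgue_number R R `[0, 1]%classic (fun s t => nrm (g s - g t) < e /\
    `|theta s - theta t| < pi / 2) (@segment_compact _ _ _).
  move=> t0 t01; have e20 : 0 < e / 2 by rewrite divr_gt0.
  have pi40 : 0 < pi / 4 :> R by rewrite divr_gt0 // pi_gt0.
  have ct : \forall t \near t0, t \in `[0, 1] -> `|theta t0 - theta t| < pi / 4.
    have /subspace_continuousP/(_ t0 t01)/cvgrPdist_lt/(_ _ pi40) := ctheta.
    by rewrite withinE /= => -[V pV E]; apply: filterS pV => p Vp Kp;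
       have : (V `&` `[0, 1]) p by []; rewrite -E => -[].
  exists [set t | nrm (g t0 - g t) < e / 2 /\ (t \in `[0, 1] -> `|theta t0 - theta t| < pi
    / 4)].
    by apply: filterI; [exact: cg|exact: ct].
  move=> s t /= [gs ts] [gt tt] s01 t01'; split.
    have := nrm_dist3 (g s) (g t0) (g t); rewrite (nrmB_sym (g s) (g t0)); lra.
  have := ts s01; have := tt t01'; rewrite !ltr_norml => /andP[a b] /andP[c d].
  by apply/andP; split; lra.
by exists d.
Qed.

(** The grid argument runs on pairs (x, t) with t an argument of alpha x / alpha z, so that end
    point and argument are obtained together. Rows are indexed by the homotopy parameter. *)
Lemma homotopy_invariance (g1 g2 : R -> 'cV[Cx R]_n) (theta1 theta2 : R -> R) :
  nrm_continuous01 g1 -> nrm_continuous01 g2 ->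
  {within `[0, 1], continuous theta1} -> {within `[0, 1], continuous theta2} ->
  (forall t : R, t \in `[0, 1] -> X (g1 t) /\ arg_at (g1 t) (theta1 t)) ->
  (forall t : R, t \in `[0, 1] -> X (g2 t) /\ arg_at (g2 t) (theta2 t)) ->
  g1 0 = g2 0 -> theta1 0 = theta2 0 ->
  path_homotopic (fun t => proj (g1 t)) (fun t => proj (g2 t)) ->
  g1 1 = g2 1 /\ theta1 1 = theta2 1.
Proof.
move=> cg1 cg2 ct1 ct2 X1 X2 g0 t0 [F [cF F01 Fends]].
pose K : set (R * R) := `[0, 1] `*` `[0, 1].
have cK : compact K by apply: compact_setX; exact: segment_compact.
have [e4 e40 sep] := uniform_separation WG Wfree z cF cK.
(* A quarter, because separation has to survive four close steps in [grid_monodromy]. *)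
pose e := e4 / 4; have e0 : 0 < e by rewrite divr_gt0.
have [|d d0 dP] := @lebesgue_number R _ K (fun p q =>
    forall x (s : R), X x -> proj x = F p -> arg_at x s ->
    exists y (t : R), [/\ X y, proj y = F q, arg_at y t, nrm (x - y) < e & `|s - t| < pi /
      2]) cK.
  by move=> p0 Kp0; exact: (local_matching WG z alphaX cF e0 Kp0).
have [d1 d10 d1P] := uniform_small_steps e0 cg1 ct1.
have [d2 d20 d2P] := uniform_small_steps e0 cg2 ct2.
(* The mesh 1 / (N + 1) lies below the thresholds of the homotopy and of both paths. *)
have [N /= [Nd Nd1 Nd2]] : exists N : nat, [/\ N.+1%:R^-1 < d, N.+1%:R^-1 < d1 & N.+1%:R^-1
  < d2].
  have := near_infty_natSinv_lt (PosNum d0); have := near_infty_natSinv_lt (PosNum d10).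
  have := near_infty_natSinv_lt (PosNum d20) => A B C.
  have ABC := filterI (filterI A B) C.
  by have [N [[a b] c]] := filter_ex (ABC _ _); exists N.
pose M := N.+1; pose c (i : nat) : R := i%:R / M%:R.
have in0 : (0 : R) \in `[0, 1] by rewrite in_itv /= lexx ler01.
have in1 : (1 : R) \in `[0, 1] by rewrite in_itv /= lexx ler01.
have M0 : M%:R != 0 :> R by rewrite pnatr_eq0.
have c01 i : (i <= M)%N -> c i \in `[0, 1].
  move=> iM; rewrite in_itv /= divr_ge0 //= ler_pdivrMr ?ltr0n // mul1r ler_nat //.
have cc i (r : R) : M%:R^-1 < r -> ball (c i) r (c i.+1).
  move=> Mr; rewrite /ball /= /c -mulrBl -opprB -natrB // subSnn mulN1r normrN.
  by rewrite ger0_norm // invr_ge0.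
(* Four steps change the argument by less than a full turn, as required by
   [has_arg_inj]. *)
pose close (a b : 'cV[Cx R]_n * R) := nrm (a.1 - b.1) < e /\ `|a.2 - b.2| < pi / 2.
pose fib i j (a : 'cV[Cx R]_n * R) := [/\ X a.1, proj a.1 = F (c i, c j) & arg_at a.1 a.2].
have c0 : c 0 = 0 by rewrite /c mul0r.
have c1 : c M = 1 by rewrite /c divff.
suff : (g1 (c M), theta1 (c M)) = (g2 (c M), theta2 (c M)) by rewrite c1 => -[-> ->].
apply: (@grid_monodromy _ close fib M (fun j => (g1 (c j), theta1 (c j)))
  (fun j => (g2 (c j), theta2 (c j)))).
- by move=> x; split; rewrite subrr ?normr0 ?nrm0 ?divr_gt0 ?pi_gt0.
- by move=> x y [a b]; split; rewrite 1?nrmB_sym 1?distrC.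
- move=> i j [x s] [y t] [x1 s1] [x2 s2] [x3 s3] iM jM [/= Xx xF xs] [/= Xy yF yt].
  move=> [/= a1 b1] [/= a2 b2] [/= a3 b3] [/= a4 b4].
  have xy : x = y.
    apply: (sep (c i, c j)) => //; first by split; exact: c01.
    have := nrm_dist3 x x1 y; have := nrm_dist3 x1 x2 y; have := nrm_dist3 x2 x3 y.
    by rewrite /e in a1 a2 a3 a4; lra.
  congr pair => //; apply: has_arg_inj xs _ _; first by rewrite xy.
  move: b1 b2 b3 b4; rewrite !ltr_norml => /andP[? ?] /andP[? ?] /andP[? ?] /andP[? ?].
  by rewrite mulr2n; apply/andP; split; lra.
- move=> i j [x s] iM jM [/= Xx xF xs].
  have [|||y [t [Xy yF yt xy st]]] := dP (c i, c j) (c i.+1, c j) _ _ _ x s Xx xF xs.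
  + by split; apply: c01 => //; exact: ltnW.
  + by split; apply: c01.
  + by split; [exact: cc|exact: ballxx].
  by exists (y, t).
- move=> i j [x s] iM jM [/= Xx xF xs].
  have [|||y [t [Xy yF yt xy st]]] := dP (c i, c j) (c i, c j.+1) _ _ _ x s Xx xF xs.
  + by split; apply: c01 => //; exact: ltnW.
  + by split; apply: c01.
  + by split; [exact: ballxx|exact: cc].
  by exists (y, t).
- move=> j jM; have [X1j a1j] := X1 _ (c01 j jM).
  by split => //=; rewrite c0 (F01 _ (c01 j jM)).1.
- move=> j jM; have [X2j a2j] := X2 _ (c01 j jM).
  by split => //=; rewrite c1 (F01 _ (c01 j jM)).2.
- by move=> j jM; apply: d1P; [exact/c01/ltnW|exact: c01|exact: cc].
- by move=> j jM; apply: d2P; [exact/c01/ltnW|exact: c01|exact: cc].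
- move=> i iM; have [F0 F1] := Fends _ (c01 i iM).
  have [X10 a10] := X1 0 in0; have [X11 a11] := X1 1 in1.
  by split; split; rewrite /= ?c0 ?c1 ?F0 ?F1.
- by rewrite c0 g0 t0.
Qed.

End HomotopyInvariance.

(** * Explicit elements of the braid group *)

Section C1Paths.
Context {R : realType}.

Lemma C1_derive (f df : R -> R) :
  (forall t : R, is_derive t 1 f (df t)) -> continuous df -> C1 f.
Proof.
move=> fdf cdf; split=> [t|]; first by have [] := fdf t.
rewrite (_ : derive1 f = df) //; apply/funext => t.
by rewrite derive1E; have [_ ->] := fdf t.
Qed.

Lemma C1_cst (k : R) : C1 (fun _ => k).
Proof.
apply: (@C1_derive (fun _ => k) (fun _ => 0)) => t; exact: cvg_cst.
Qed.

Lemma C1_comb (f g : R -> R) (a b c : R) : C1 f -> C1 g ->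
  C1 (fun t => a + (f t * b + g t * c)).
Proof.
move=> [df cf] [dg cg].
have Df (t : R) : is_derive t 1 f (derive1 f t) by rewrite derive1E; apply: derivableP;
  exact: df.
have Dg (t : R) : is_derive t 1 g (derive1 g t) by rewrite derive1E; apply: derivableP;
  exact: dg.
refine (@C1_derive (fun t => a + (f t * b + g t * c)) (fun t =>
  derive1 f t * b + derive1 g t * c) _ _).
  move=> t; apply: is_derive_eq (is_derive1D (is_derive1_cst a t)
    (is_derive1D (is_derive1M (Df t) (is_derive1_cst b t))
                 (is_derive1M (Dg t) (is_derive1_cst c t)))) _.
  by rewrite add0r !mulr0 !addr0.
move=> t; apply: cvgD; [exact: cvgM (cf t) (cvg_cst _)|exact: cvgM (cg t) (cvg_cst _)].
Qed.

(** Covers both the loop exp(2 pi i t) z and the arcs in the complex line through two points. *)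
Lemma C1_path_line n (u v : 'cV[Cx R]_n) (l : R -> Cx R) :
  C1 (fun t => complex.Re (l t)) -> C1 (fun t => complex.Im (l t)) ->
  C1_path (fun t => u + l t *: v).
Proof.
move=> lR lI i; split.
  rewrite (_ : (fun t => _) = fun t => complex.Re (u i 0) +
    (complex.Re (l t) * complex.Re (v i 0) + complex.Im (l t) * - complex.Im (v i 0))).
    exact: C1_comb.
  by apply/funext => t; rewrite !mxE ReDc ReMc mulrN.
rewrite (_ : (fun t => _) = fun t => complex.Im (u i 0) +
  (complex.Re (l t) * complex.Im (v i 0) + complex.Im (l t) * complex.Re (v i 0))).
  exact: C1_comb.
by apply/funext => t; rewrite !mxE ImDc ImMc.
Qed.

Lemma C1_path_cvg n (g : R -> 'cV[Cx R]_n) (t0 : R) : C1_path g -> g t @[t --> t0] --> g t0.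
Proof.
move=> gC1.
have cC1 (f : R -> R) : C1 f -> {for t0, continuous f}.
  by move=> [df _]; apply/differentiable_continuous/derivable1_diffP.
apply: (@cvg_coord _ _ (nbhs t0)) => i j; apply: (@cvg_absc1 _ _ (nbhs t0)) => e e0.
have e20 : 0 < e / 2 by rewrite divr_gt0.
have /cvgrPdist_lt/(_ _ e20) cR := cC1 _ (gC1 i).1.
have /cvgrPdist_lt/(_ _ e20) cI := cC1 _ (gC1 i).2.
apply: filterS (filterI cR cI) => t [/= tR tI].
rewrite ord1 /absc1 ReDc ImDc ReNc ImNc; lra.
Qed.

End C1Paths.

Section LiftPath.
Context {R : realType} {n : nat} (W : {fset 'M[Cx R]_n}).
Hypothesis WG : is_GL_subgroup [set` W].
Local Notation X := (regular_part W).
Hypothesis Wfree : acts_freely W X.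
Variable z : X.
Local Notation proj := (orbit_proj W z).

Let Xz : X (val z). Proof. exact/set_mem/valP. Qed.

(* The first three properties also hold for the default value of [lift_path],
   so that periodicity does not rely on the existence of lifts. *)
Lemma lift_path_spec sigma : let g := lift_path z sigma in
  [/\ C1_path g, forall t : R, t \in `[0, 1] -> X (g t), g 0 = val z
    & braid_group z sigma -> exists2 w, w \in W & g 1 = w *m val z].
Proof.
rewrite /lift_path; set S := (S in xget _ S).
have [/(xgetPex (fun=> val z))|S0] := pselect (exists g, S g).
  move: (xget _ S) => g [gC1 gX g0 gsigma] /=.
  split => // -[f _ E]; move: gsigma; rewrite E => -[[_ _ g1] _].
  have Xg1 : X (g 1) by refine (gX 1 _); rewrite in_itv /= ler01 lexx.
  by apply/(orbit_projP WG z Xz Xg1); rewrite g1.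
rewrite (_ : xget (fun=> val z) S = fun=> val z); last first.
  by apply: xgetPN => g Sg; apply: S0; exists g.
split => //; last by exists 1%:M; [exact: (group_mx1 WG)|rewrite mul1mx].
by move=> i; split; exact: C1_cst.
Qed.

Lemma braid_proj_spec sigma : braid_group z sigma ->
  braid_proj z sigma \in W /\ lift_path z sigma 1 = braid_proj z sigma *m val z.
Proof.
move=> Bs; have [_ _ _ /(_ Bs)[w wW gw]] := lift_path_spec sigma.
exact: (@xgetPex _ 1%:M [set w | w \in W /\ lift_path z sigma 1 = w *m val z]
  (ex_intro _ w (conj wW gw))).
Qed.

(** The lift chosen for the class of the projected g need not be g; what relates the two is a
    homotopy in X/W, to which [homotopy_invariance] applies. *)
Lemma braid_class (g : R -> 'cV[Cx R]_n) w : C1_path g ->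
  (forall t : R, t \in `[0, 1] -> X (g t)) -> g 0 = val z -> w \in W -> g 1 = w *m val z ->
  exists2 sigma, braid_group z sigma &
    [/\ C1_path (lift_path z sigma),
        (forall t : R, t \in `[0, 1] -> X (lift_path z sigma t)),
        lift_path z sigma 0 = val z
      & path_homotopic (fun t => proj (g t)) (fun t => proj (lift_path z sigma t))].
Proof.
move=> gC1 gX g0 wW g1; pose f := fun t => proj (g t).
have in1 : (1 : R) \in `[0, 1] by rewrite in_itv /= lexx ler01.
have f1 : f 1 = proj (val z) by rewrite /f g1 (proj_mul WG z wW Xz).
have floop : is_loop (proj (val z)) f.
  split => //; last by rewrite /f g0.
  apply/subspace_continuousP => t t01;
    apply: (@proj_continuous _ _ _ z _ (within `[0, 1] (nbhs t)) g) => //.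
  - exact: gX.
  - by apply: cvg_within_filter; exact: C1_path_cvg.
  - by apply: filterS (near_withinT _ _) => s; exact: gX.
have ff : path_homotopic f f.
  exists (fun p => f p.2); split => //.
  apply/subspace_continuousP => -[s t] [/= s01 t01].
  apply: (@proj_continuous _ _ _ z _ (within (`[0, 1] `*` `[0, 1]) (nbhs (s, t))) (fun p =>
    g p.2)) => //.
  - exact: gX.
  - apply: cvg_within_filter; apply: (@cvg_comp _ _ _ snd g _ (nbhs t)); first exact: cvg_snd.
    exact: C1_path_cvg.
  - by apply: filterS (near_withinT _ _) => -[s' t'] [_ /=]; exact: gX.
pose sigma := [set h | is_loop (proj (val z)) h /\ path_homotopic f h].
exists sigma; first by exists f.
(* g itself belongs to the set, so the choice does not fall back on its default. *)
have [lC1 lX l0 [_ lf]] := @xgetPex _ (fun=> val z)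
  [set g' | [/\ C1_path g', forall t : R, t \in `[0, 1] -> X (g' t),
                 g' 0 = val z & sigma (fun t => proj (g' t))]]
  (ex_intro _ g (And4 gC1 gX g0 (conj floop ff))).
by split.
Qed.

(** Computes both invariants of a class from one explicit path, whatever lift was chosen. *)
Lemma lift_path_invariants (g : R -> 'cV[Cx R]_n) w
    (alpha : 'Hom('cV[Cx R]_n, (Cx R)^o)) (theta : R -> R) :
  (forall x, X x -> alpha x != 0) -> C1_path g ->
  (forall t : R, t \in `[0, 1] -> X (g t)) -> g 0 = val z -> w \in W -> g 1 = w *m val z ->
  {within `[0, 1], continuous theta} -> theta 0 = 0 ->
  (forall t : R, t \in `[0, 1] -> has_arg ((alpha (g t) : Cx R) / alpha (val z)) (theta t)) ->
  exists2 sigma, braid_group z sigma &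
    braid_proj z sigma = w /\
    complex.Im (dlog_integral alpha (lift_path z sigma)) = theta 1.
Proof.
move=> alphaX gC1 gX g0 wW g1 ctheta theta0 gtheta.
have [sigma Bs [lC1 lX l0 hom]] := braid_class gC1 gX g0 wW g1.
have alz := alphaX _ Xz.
have [_ [P [Q [cQ Q0 Q1 lift]]]] := dlog_lift lC1 (fun t t01 => alphaX _ (lX t t01)).
have lQ (t : R) : t \in `[0, 1] ->
    has_arg ((alpha (lift_path z sigma t) : Cx R) / alpha (val z)) (Q t).
  by move=> t01; rewrite lift // l0 mulrC mulKf //; exact: has_arg_expc.
have cn (h : R -> 'cV[Cx R]_n) : C1_path h -> nrm_continuous01 h.
  move=> hC1 t0 _ e e0; exact: (C1_path_cvg hC1 (nbhs_nrm (h t0) e0)).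
have [||||E1 E2] := homotopy_invariance WG Wfree alphaX (cn _ gC1) (cn _ lC1) ctheta cQ _ _
  _ _ hom.
- by move=> t t01; split; [exact: gX|exact: gtheta].
- by move=> t t01; split; [exact: lX|exact: lQ].
- by rewrite g0 l0.
- by rewrite theta0 Q0.
exists sigma => //; split; last by rewrite -Q1 E2.
have [pW pE] := braid_proj_spec Bs.
set w' := braid_proj z sigma in pW pE *.
(* Freeness turns the equality of end points w z = w' z into w = w'. *)
have ww : invmx w *m w' = 1%:M.
  apply: (Wfree _ Xz); first by rewrite (group_mulmx WG) ?(group_invmx WG).
  by rewrite -mulmxA -pE -E1 g1 mulKmx // (group_unitmx WG).
by rewrite -[w'](mulKVmx (group_unitmx WG wW)) ww mulmx1.
Qed.

End LiftPath.

Section Loops.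
Context {R : realType} {n : nat} (W : {fset 'M[Cx R]_n}).
Hypothesis WG : is_GL_subgroup [set` W].
Local Notation A := (arrangement W).
Local Notation X := (regular_part W).
Hypothesis Wfree : acts_freely W X.
Variable z : X.
Variable alpha : A -> 'Hom('cV[Cx R]_n, (Cx R)^o).
Hypothesis alpha_ker : forall H, lker (alpha H) = val H.

Lemma alpha_regular H x : X x -> alpha H x != 0.
Proof. by move=> Xx; rewrite (alpha_eq0 alpha_ker); exact: Xx. Qed.

Lemma regular_alpha x : (forall H, alpha H x != 0) -> X x.
Proof. by move=> ax H; rewrite -(alpha_eq0 alpha_ker); exact: ax. Qed.

Let Xz : X (val z). Proof. exact/set_mem/valP. Qed.

(** The loop multiplies every alpha_K by the same factor of modulus 1, so it stays in X and winds
    once around each hyperplane. *)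
Lemma full_twist (H : A) : exists2 sigma, braid_group z sigma &
  braid_proj z sigma = 1%:M /\
  complex.Im (dlog_integral (alpha H) (lift_path z sigma)) = pi *+ 2.
Proof.
pose l (t : R) : Cx R := expc (Complex 0 (t * pi *+ 2)).
pose g (t : R) := 0 + l t *: val z.
have alg K t : alpha K (g t) = l t * alpha K (val z) by rewrite /g add0r linearZ.
have dl (t : R) : is_derive t 1 (fun s : R => s * pi *+ 2 : R) (pi *+ 2).
  rewrite (_ : (fun s => _) = (fun s : R => pi *+ 2 * s)); last first.
    by apply/funext => s; rewrite mulrnAl mulrC.
  by apply: is_derive_eq (is_derive1Zl (pi *+ 2) (is_derive1_id t)) _; rewrite mulr1.
have cl : continuous (fun s : R => s * pi *+ 2 : R) by move=> t;
  exact: is_derive1_continuous (dl t).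
have dc (t : R) : is_derive t 1 (fun s => complex.Re (l s)) (- sin (t * pi *+ 2) * pi *+ 2).
  rewrite (_ : (fun s => _) = cos \o (fun s : R => s * pi *+ 2)); last first.
    by apply/funext => s; rewrite /= expR0 mul1r.
  by apply: is_derive_eq (is_derive1_comp (is_derive_cos _) (dl t)) _; exact: mulrnAr.
have ds (t : R) : is_derive t 1 (fun s => complex.Im (l s)) (cos (t * pi *+ 2) * pi *+ 2).
  rewrite (_ : (fun s => _) = sin \o (fun s : R => s * pi *+ 2)); last first.
    by apply/funext => s; rewrite /= expR0 mul1r.
  by apply: is_derive_eq (is_derive1_comp (is_derive_sin _) (dl t)) _; exact: mulrnAr.
have cmul (f : R -> R) : continuous f -> continuous (fun t : R => f t * pi *+ 2).
  have -> : (fun t : R => f t * pi *+ 2) = (fun t => f t * (pi *+ 2)).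
    by apply/funext => s; rewrite -mulrnAr.
  move=> cf t; exact: cvgM (cf t) (cvg_cst _).
have csin : continuous (fun s : R => sin (s * pi *+ 2)).
  by move=> t; apply: continuous_comp; [exact: cl|exact: continuous_sin].
have ccos : continuous (fun s : R => cos (s * pi *+ 2)).
  by move=> t; apply: continuous_comp; [exact: cl|exact: continuous_cos].
have lC1 : C1_path g.
  apply: C1_path_line.
    apply: (C1_derive dc); apply: (cmul (fun t : R => - sin (t * pi *+ 2))).
    by move=> t; exact: cvgN (csin t).
  by apply: (C1_derive ds); exact: cmul.
have gX (t : R) : t \in `[0, 1] -> X (g t).
  move=> _; apply: regular_alpha => K; rewrite alg mulf_neq0 ?expc_neq0 //.
  exact: alpha_regular.
have g0 : g 0 = val z.
  by rewrite /g /l mul0r mul0rn (_ : Complex 0 0 = 0) // expc0 scale1r add0r.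
have g1 : g 1 = 1%:M *m val z.
  rewrite /g /l mul1r /expc /= cos2pi sin2pi expR0 mulr1 mulr0.
  by rewrite (_ : Complex 1 0 = 1) // scale1r add0r mul1mx.
have garg (t : R) : t \in `[0, 1] ->
    has_arg ((alpha H (g t) : Cx R) / alpha H (val z)) (t * pi *+ 2).
  by move=> _; rewrite alg mulfK ?alpha_regular //; exact: has_arg_expc.
have th0 : 0 * pi *+ 2 = 0 :> R by rewrite mul0r mul0rn.
have [sigma Bs [ps Is]] := lift_path_invariants WG Wfree (alpha_regular H) lC1 gX g0
  (group_mx1 WG) g1
  (continuous_subspaceT cl) th0 garg.
by exists sigma => //; rewrite Is mul1r.
Qed.

Lemma avoiding_path x y : X x -> X y -> exists g : R -> 'cV[Cx R]_n,
  [/\ C1_path g, forall t : R, t \in `[0, 1] -> X (g t), g 0 = x & g 1 = y].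
Proof.
move=> Xx Xy.
(* On the complex line through x and y, the hyperplane H excludes only the
   parameter mu H, which t + i s t (1 - t) takes only if s = bad H. *)
pose mu H : Cx R := (alpha H x : Cx R) / ((alpha H x : Cx R) - alpha H y).
pose bad H : R := complex.Im (mu H) / (complex.Re (mu H) * (1 - complex.Re (mu H))).
pose s : R := 1 + \sum_H `|bad H|.
have s_bad H : s != bad H.
  apply/eqP; have h1 := ler_norm (bad H).
  have h2 : 0 <= \sum_(i | i != H) `|bad i| by rewrite sumr_ge0.
  have h3 : s = 1 + (`|bad H| + \sum_(i | i != H) `|bad i|) by rewrite /s (bigD1 H).
  by lra.
pose l (t : R) : Cx R := Complex t (s * (t * (1 - t))).
have lC1 : C1_path (fun t => x + l t *: (y - x)).
  apply: C1_path_line.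
    by apply: (@C1_derive _ _ (fun=> 1)) => t; exact: cvg_cst.
  have dl (t : R) : is_derive t 1 (fun t => complex.Im (l t)) (s * (1 - 2 * t)).
    apply: is_derive1Zl; apply: is_derive_eq (is_derive1M (is_derive1_id t)
      (is_derive1B (is_derive1_cst 1 t) (is_derive1_id t))) _.
    by ring.
  apply: (C1_derive dl) => t; apply: cvgM; first exact: cvg_cst.
  by apply: cvgB; [exact: cvg_cst|apply: cvgM; [exact: cvg_cst|exact: cvg_id]].
exists (fun t => x + l t *: (y - x)); split => //.
- move=> t t01; apply: regular_alpha => H; apply/eqP => E.
  have ax := alpha_regular H Xx; have ay := alpha_regular H Xy.
  have {}E : (alpha H x : Cx R) = l t * ((alpha H x : Cx R) - alpha H y).
    move: E; rewrite linearD linearZ linearB /= /GRing.scale /= => /eqP.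
    by rewrite addr_eq0 -mulrN opprB => /eqP.
  have d0 : (alpha H x : Cx R) - alpha H y != 0.
    by apply: contraNneq ax => d0; rewrite E d0 mulr0.
  have muE : mu H = l t by rewrite /mu {1}E mulfK.
  have t0 : t != 0.
    apply: contraNneq ax => t0; rewrite E /l t0 mul0r mulr0.
    by rewrite (_ : Complex 0 0 = 0) // mul0r.
  have t1 : 1 - t != 0.
    rewrite subr_eq0 eq_sym; apply: contraNneq ay => t1; apply/eqP.
    move: E; rewrite /l t1 subrr !mulr0 (_ : Complex 1 0 = 1) // mul1r => /eqP.
    by rewrite eq_sym -subr_eq0 addrAC subrr add0r oppr_eq0 => /eqP.
  move: (s_bad H); rewrite /bad muE /l /= mulfK ?eqxx //.
  by rewrite mulf_neq0.
- by rewrite /l mul0r mulr0 (_ : Complex 0 0 = 0) // scale0r addr0.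
- by rewrite /l subrr !mulr0 (_ : Complex 1 0 = 1) // scale1r addrC subrK.
Qed.

Lemma braid_proj_surj (H : A) w : w \in W ->
  exists2 sigma, braid_group z sigma & braid_proj z sigma = w.
Proof.
move=> wW; have [g [gC1 gX g0 g1]] := avoiding_path Xz (regular_part_stable WG wW Xz).
have alX x : X x -> alpha H x != 0 by exact: alpha_regular.
have [_ [P [Q [cQ Q0 _ lift]]]] := dlog_lift gC1 (fun t t01 => alX _ (gX t t01)).
have garg (t : R) : t \in `[0, 1] ->
    has_arg ((alpha H (g t) : Cx R) / alpha H (val z)) (Q t).
  by move=> t01; rewrite lift // g0 mulrC mulKf ?alX //; exact: has_arg_expc.
have [sigma Bs [ps _]] := lift_path_invariants WG Wfree alX gC1 gX g0 wW g1 cQ Q0 garg.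
by exists sigma.
Qed.

End Loops.

(** * The representations *)

Section Representation.
Context {R : realType} {n : nat} (W : {fset 'M[Cx R]_n}).
Hypothesis WG : is_GL_subgroup [set` W].
Local Notation A := (arrangement W).
Local Notation X := (regular_part W).
Local Notation N := #|{: A}|.
Variable z : X.
Variable alpha : A -> 'Hom('cV[Cx R]_n, (Cx R)^o).
Hypothesis alpha_ker : forall H, lker (alpha H) = val H.
Local Notation I H sigma := (dlog_integral (alpha H) (lift_path z sigma)).

Lemma prod_diag_mx (J : Type) (s : seq J) (m : nat) (d : J -> 'rV[Cx R]_m) :
  \prod_(j <- s) diag_mx (d j) = diag_mx (\row_i \prod_(j <- s) d j 0 i).
Proof.
elim: s => [|j s IH].
  rewrite big_nil; apply/matrixP => i k; rewrite !mxE big_nil.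
  by rewrite eq_sym.
rewrite big_cons IH -mulmxE mulmx_diag; congr diag_mx.
by apply/rowP => i; rewrite !mxE big_cons.
Qed.

(** The exponential factors are diagonal, and the factor of H differs from the identity at most at
    the index of H. *)
Lemma Rh_entry (h : Cx R) sigma i j :
  Rh z alpha h sigma i j =
  expc (h * I (enum_val i) sigma) * (maps (braid_proj z sigma) (enum_val j) (enum_val i))%:R.
Proof.
rewrite /Rh; pose d (H : A) : 'rV[Cx R]_N :=
  \row_k (if k == enum_rank H then expc (h * I H sigma) else 1).
rewrite (eq_bigr (fun H => diag_mx (d H))); last first.
  move=> H _; rewrite /projector expmx_delta; apply/matrixP => k l; rewrite !mxE.
  have [->|kl] := eqVneq k l; last first.
    have [kH|] := eqVneq k (enum_rank H); last by rewrite mulr0 addr0.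
    by rewrite -kH eq_sym (negbTE kl) mulr0 addr0.
  case: (l == enum_rank H) => /=; last by rewrite mulr0 addr0.
  by rewrite mulr1 !mulr1n addrC subrK.
rewrite prod_diag_mx mul_diag_mx !mxE; congr (_ * _).
rewrite (bigD1 (enum_val i)) //= mxE enum_valK eqxx big1 ?mulr1 // => H Hi.
by rewrite mxE ifN //; apply: contraNneq Hi => ->; rewrite enum_rankK.
Qed.

Lemma expc_dlog H sigma : braid_group z sigma ->
  expc (I H sigma) = (alpha H (braid_proj z sigma *m val z) : Cx R) / alpha H (val z).
Proof.
move=> Bs; have [_ pE] := braid_proj_spec WG Bs.
have [gC1 gX g0 _] := lift_path_spec WG z sigma.
have aX x : X x -> alpha H x != 0 by exact: alpha_regular.
have [E _] := dlog_lift gC1 (fun t t01 => aX _ (gX t t01)).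
rewrite -pE E g0 mulrC mulKf //; apply: aX; exact/set_mem/valP.
Qed.

Lemma Rh0 sigma : Rh z alpha 0 sigma = R0 W (braid_proj z sigma).
Proof. by apply/matrixP => i j; rewrite Rh_entry mxE mul0r expc0 mul1r. Qed.

(** The second hypothesis makes the cocycle exp(k int omega) a coboundary of q; it is the equality
    of the (K, H) entries of the two products after cancelling exp(h int omega_K). *)
Lemma diag_intertwiner (q : A -> Cx R) (h k : Cx R) :
  (forall H, q H != 0) ->
  (forall sigma H K, braid_group z sigma -> maps (braid_proj z sigma) H K ->
     q K * expc (k * I K sigma) = q H) ->
  rep_iso z (Rh z alpha (h + k)) (Rh z alpha h).
Proof.
move=> q0 qE; exists (diag_mx (\row_i q (enum_val i))).
  rewrite unitmxE det_diag unitfE; apply/prodf_neq0 => i _; rewrite mxE; exact: q0.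
move=> sigma Bs; rewrite mul_diag_mx mul_mx_diag; apply/matrixP => i j.
have dE (k' : 'I_N) : (\row_(k < N) q (enum_val k)) 0 k' = q (enum_val k') by rewrite mxE.
rewrite [LHS]mxE [RHS]mxE (dE i) (dE j).
refine (etrans (congr1 ( *%R _) (Rh_entry (h + k) sigma i j))
  (etrans _ (congr1 ( *%R^~ _) (esym (Rh_entry h sigma i j))))).
rewrite /=.
case: (boolP (maps _ _ _)) => [m|_]; last by rewrite !(mulr0, mul0r).
rewrite -(qE _ _ _ Bs m) mulrDl expcD; ring.
Qed.

End Representation.

(** Equality case of the triangle inequality: real parts are at most 1 and their sum leaves no
    deficit, so each is 1 and the imaginary parts vanish. *)
Lemma unit_complex_sum (R : realType) (J : finType) (P : pred J) (a : J -> Cx R) :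
  (forall j, P j -> `|a j| = 1) -> \sum_(j | P j) a j = \sum_(j | P j) 1 ->
  forall j, P j -> a j = 1.
Proof.
move=> a1 sa.
have sq j : P j -> complex.Re (a j) ^+ 2 + complex.Im (a j) ^+ 2 = 1.
  move=> /a1; rewrite normc_def => -[/(congr1 (fun x : R => x ^+ 2))].
  by rewrite sqr_sqrtr ?addr_ge0 ?sqr_ge0 // expr1n.
have Re1 j : P j -> 0 <= 1 - complex.Re (a j).
  by move=> /sq; have := sqr_ge0 (complex.Im (a j)); nra.
have : \sum_(j | P j) (1 - complex.Re (a j)) = 0.
  have Rsum (F : J -> Cx R) : complex.Re (\sum_(j | P j) F j) = \sum_(j | P j) complex.Re
    (F j).
    by rewrite (big_morph _ (@ReDc R) (erefl (complex.Re (0 : Cx R)))).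
  rewrite sumrB -Rsum sa Rsum; apply/eqP; rewrite subr_eq0; exact/eqP.
move=> /eqP; rewrite psumr_eq0 // => /allP sum0 j Pj.
have := sum0 j (mem_index_enum j); rewrite Pj /= subr_eq0 => /eqP Rej.
have := sq j Pj; rewrite -Rej expr1n => /eqP; rewrite eq_sym -subr_eq0 opprD addrA subrr add0r.
rewrite oppr_eq0 sqrf_eq0 => /eqP Imj.
by case: (a j) Rej Imj => x y /= <- ->.
Qed.

(** With m the integer part of c, the number 1 has both 2 pi (c - m) and 0 as arguments; they differ
    by less than a turn, so c = m. *)
Lemma has_arg1_nat (R : realType) (c : R) :
  0 <= c -> has_arg 1 (c * pi *+ 2) -> exists m : nat, c = m%:R.
Proof.
move=> c0 c1.
have arg2pi (m : nat) : has_arg (1 : Cx R) (m%:R * pi *+ 2).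
  elim: m => [|m IH].
    rewrite mul0r mul0rn; have := @has_arg_expc R 0 0.
    by rewrite (_ : Complex 0 0 = 0) // expc0.
  have : has_arg (1 : Cx R) (pi *+ 2).
    by exists 1 => //; rewrite cos2pi sin2pi mulr1 mulr0.
  rewrite (_ : m.+1%:R * pi *+ 2 = m%:R * pi *+ 2 + pi *+ 2); last first.
    by rewrite -[m.+1%:R]natr1 mulrDl mul1r mulrnDl.
  by move=> /(has_argM IH); rewrite mulr1.
have /andP[] := truncn_itv c0; set m := Num.trunc c; rewrite -natr1 => m1 m2.
have pi0 : 0 < pi *+ 2 :> R by rewrite mulrn_wgt0 // pi_gt0.
have := has_argM c1 (has_argV (arg2pi m)); rewrite invr1 mulr1 => cm.
exists m; have := has_arg_inj cm (arg2pi 0).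
rewrite mul0r mul0rn subr0 -!mulrnAr -mulrBl normrM (gtr0_norm pi0) gtr_pMl // => /(_ _)/eqP.
rewrite mulf_eq0 (gt_eqF pi0) orbF subr_eq0 => /(_ _)/eqP; apply.
by rewrite ger0_norm; lra.
Qed.

(** * Periodicity and minimality of kappa *)

Section Main.
Context {R : realType} {n : nat} (W : {fset 'M[Cx R]_n}).
Hypothesis WG : is_GL_subgroup [set` W].
Local Notation A := (arrangement W).
Local Notation X := (regular_part W).
Hypothesis Wfree : acts_freely W X.
Variable phi : {dot 'cV[Cx R]_n for Num.conj}.
Hypothesis phiW : forall w, w \in W ->
  forall u v : 'cV[Cx R]_n, phi (w *m u) (w *m v) = phi u v.
Variable e : A -> 'cV[Cx R]_n.
Hypothesis e_neq0 : forall H, e H != 0.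
Hypothesis e_orth : forall (H : A) (u : 'cV[Cx R]_n), u \in val H -> phi u (e H) = 0.
Variable alpha : A -> 'Hom('cV[Cx R]_n, (Cx R)^o).
Hypothesis alpha_ker : forall H, lker (alpha H) = val H.
Variable z : X.
Local Notation I H sigma := (dlog_integral (alpha H) (lift_path z sigma)).

Let Xz : X (val z). Proof. exact/set_mem/valP. Qed.
Let az H : alpha H (val z) != 0. Proof. exact: alpha_regular. Qed.

(** [u] will transport one root per orbit to all hyperplanes of that orbit. [r] is constant on
    orbits because [choose] receives extensionally equal predicates there. *)
Lemma orbit_representatives : exists (r : A -> A) (u : A -> 'M[Cx R]_n),
  (forall H, u H \in W /\ maps (u H) (r H) H) /\
  (forall w (H K : A), w \in W -> maps w H K -> r H = r K).
Proof.
pose conn (H K : A) : bool := `[< exists2 w, w \in W & maps w K H >].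
have connxx (H : A) : conn H H by apply/asboolP; exists 1%:M;
  [exact: (group_mx1 WG)|exact: (maps1 WG)].
pose r (H : A) : A := choose (fun K => conn H K) H.
have rP (H : A) : conn H (r H) by apply: chooseP.
have /choice[u uP] : forall H, exists u, u \in W /\ maps u (r H) H.
  by move=> H; have /asboolP[w wW wr] := rP H; exists w.
exists r, u; split => // w H K wW wHK.
have E : conn H =1 conn K.
  move=> L; apply/asboolP/asboolP => -[v vW vL].
    by exists (w *m v); [exact: (group_mulmx WG)|exact: (mapsM WG vW wW vL wHK)].
  exists (invmx w *m v); first by rewrite (group_mulmx WG) ?(group_invmx WG).
  exact: (mapsM WG vW (group_invmx WG wW) vL (mapsV WG wW wHK)).
rewrite /r (eq_choose E); apply: choose_id => //.
by apply/asboolP; exists w.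
Qed.

Lemma maps_alpha_e_neq0 w (H K : A) : w \in W -> maps w H K -> alpha K (w *m e H) != 0.
Proof.
move=> wW wHK; rewrite (alpha_eq0 alpha_ker) (maps_mem WG _ wW wHK).
rewrite -(alpha_eq0 alpha_ker); exact: (alpha_e_neq0 e_neq0 e_orth alpha_ker).
Qed.

Lemma Rh_periodic (kappa : nat) : kappa_set e kappa ->
  forall h : Cx R, rep_iso z (Rh z alpha (h + kappa%:R)) (Rh z alpha h).
Proof.
move=> [_ kappaP] h; have [r [u [uP rP]]] := orbit_representatives.
(* [y] is W-equivariant up to kappa-th roots of unity. *)
pose y (H : A) := u H *m e (r H).
have ay (H : A) : alpha H (y H) != 0.
  by have [uW ur] := uP H; exact: maps_alpha_e_neq0.
(* The ratio is unchanged when alpha_H is rescaled, and the power absorbs the roots of unity by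
   which y fails to be equivariant. *)
pose q (H : A) : Cx R := ((alpha H (val z) : Cx R) / alpha H (y H)) ^+ kappa.
refine (diag_intertwiner (z := z) (alpha := alpha) (q := q) h (k := kappa%:R) _ _).
  by move=> H; rewrite expf_neq0 // mulf_neq0 // invr_neq0.
move=> sigma H K Bs; have [pW _] := braid_proj_spec WG Bs.
set w := braid_proj z sigma in pW * => wHK.
rewrite mulrC [kappa%:R * _]mulr_natl expcMn (expc_dlog WG alpha_ker) // -/w.
have [uHW uH] := uP H; have [uKW uK] := uP K.
have rHK := rP w H K pW wHK.
(* The element u_K^-1 w u_H stabilizes r K, so e (r K) is an eigenvector of it, and the definition
   of kappa applies to the eigenvalue. *)
have [zeta zeta1 wy] : exists2 zeta : Cx R, zeta ^+ kappa = 1 & w *m y H = zeta *: y K.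
  pose v := invmx (u K) *m (w *m u H).
  have wuW : w *m u H \in W by exact: (group_mulmx WG).
  have vW : v \in W by rewrite (group_mulmx WG) ?(group_invmx WG).
  have vr : maps v (r K) (r K).
    apply: (mapsM WG wuW (group_invmx WG uKW) _ (mapsV WG uKW uK)).
    by rewrite -rHK; exact: (mapsM WG uHW pW uH wHK).
  have := stabilizer_root WG phiW e_neq0 e_orth alpha_ker vW vr.
  set zeta := _ / _ => vE; exists zeta; first exact: kappaP vE.
  by rewrite /y rHK scalemxAr -vE /v mulmxA -[in RHS]mulmxA mulKVmx ?(group_unitmx WG) //
    mulmxA.
have c0 := maps_alpha_e_neq0 pW wHK; have ae := alpha_e_neq0 e_neq0 e_orth alpha_ker H.
rewrite (maps_alpha WG e_neq0 e_orth alpha_ker (val z) pW wHK) /q -exprMn.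
have := maps_alpha WG e_neq0 e_orth alpha_ker (y H) pW wHK.
rewrite wy linearZ /= /GRing.scale /=; set c := _ / _ => cy.
have cn0 : c != 0 by rewrite mulf_neq0 // invr_neq0.
have -> : c * alpha H (val z) / alpha K (val z) * ((alpha K (val z) : Cx R) / alpha K (y K)) =
    (alpha H (val z) : Cx R) / alpha H (y H) * zeta.
  have alg (a1 a2 b1 b2 d1 s1 : Cx R) : a2 != 0 -> b1 != 0 -> b2 != 0 ->
      s1 * b2 = d1 * b1 -> d1 * a1 / a2 * (a2 / b2) = a1 / b1 * s1.
    move=> a20 b10 b20 E; have -> : s1 = d1 * b1 / b2 by rewrite -E mulfK.
    by field; apply/and3P.
  by apply: alg.
by rewrite exprMn zeta1 mulr1.
Qed.

Lemma trace_maps w (F : A -> Cx R) (M : 'M[Cx R]_#|{: A}|) :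
  (forall K : A, M (enum_rank K) (enum_rank K) = F K * (maps w K K)%:R) ->
  \tr M = \sum_(K : A | maps w K K) F K.
Proof.
move=> ME; transitivity (\sum_(K : A) (if maps w K K then F K else 0));
  last exact/esym/big_mkcond.
transitivity (\sum_(K : A) M (enum_rank K) (enum_rank K)).
  exact: (reindex _ (onW_bij _ (@enum_rank_bij {: A}))).
by apply: eq_bigr => K _; rewrite ME; case: (maps w K K); rewrite (mulr1, mulr0).
Qed.

Lemma Rh_minimal (kappa : nat) (H0 : A) : is_minimum (kappa_set e) kappa ->
  forall c : R, 0 < c ->
    rep_iso z (Rh z alpha (Cx_of_real c)) (fun sigma => R0 W (braid_proj z sigma)) ->
    kappa%:R <= c.
Proof.
move=> [_ kappa_min] c c0 [Q Qu QE].
have conj sigma : braid_group z sigma ->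
    Rh z alpha (Cx_of_real c) sigma = invmx Q *m R0 W (braid_proj z sigma) *m Q.
  by move=> Bs; rewrite -mulmxA -QE // mulKmx.
have [m cm] : exists m : nat, c = m%:R.
  apply: has_arg1_nat; first exact: ltW.
  (* R_0 sends the full twist to the identity, so any conjugate does too, and the diagonal entry at
     H0 gives exp(c int omega) = 1. *)
  have [sigma Bs [p1 I1]] := full_twist WG Wfree z alpha_ker H0.
  have R01 : R0 W 1%:M = 1%:M.
    apply/matrixP => i j; rewrite !mxE; congr ((nat_of_bool _)%:R).
    apply/idP/eqP => [/eqP E|->]; last exact: (maps1 WG).
    apply: enum_val_inj; apply: val_inj; rewrite E.
    by have /eqP <- := maps1 WG (enum_val j).
  have := conj _ Bs; rewrite p1 R01 mulmx1 mulVmx // => /matrixP.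
  move=> /(_ (enum_rank H0) (enum_rank H0)); rewrite Rh_entry p1 enum_rankK maps1 //.
  rewrite mxE eqxx mulr1 => E1.
  have -> : (1 : Cx R) = expc (Cx_of_real c * I H0 sigma) by rewrite E1.
  (* As c is real, the imaginary part of c int omega is 2 pi c. *)
  rewrite -[c * pi *+ 2]mulrnAr -I1; case: (I H0 sigma) => x y /=.
  by rewrite /Cx_of_real; have := has_arg_expc (c * x - 0 * y) (c * y + 0 * x);
    rewrite [in X in has_arg _ X]mul0r addr0.
have m0 : (0 < m)%N by move: c0; rewrite cm ltr0n.
rewrite cm ler_nat; apply: kappa_min; split=> // w H zeta wW we.
have [sigma Bs pw] := braid_proj_surj WG Wfree z alpha_ker H0 wW.
pose zt (K : A) : Cx R := (alpha K (w *m e K) : Cx R) / alpha K (e K).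
(* For w K = K the diagonal entry of R_m is the m-th power of alpha_K (w z) / alpha_K z, a ratio
   equal to the eigenvalue [zt K]. *)
have tr : \sum_(K : A | maps w K K) zt K ^+ m = \sum_(K : A | maps w K K) 1.
  transitivity (\tr (Rh z alpha (Cx_of_real c) sigma)).
    apply/esym/trace_maps => K; rewrite Rh_entry enum_rankK pw.
    case: (boolP (maps w K K)) => [wK|_]; last by rewrite !mulr0.
    have -> : Cx_of_real c = m%:R.
      rewrite cm; elim: (m) => [|k IH] //; rewrite -!natr1 -IH.
      by apply/eqP; rewrite eq_complex /= addr0 !eqxx.
    rewrite !mulr1 [m%:R * _]mulr_natl expcMn (expc_dlog WG alpha_ker) // pw.
    by rewrite (maps_alpha WG e_neq0 e_orth alpha_ker _ wW wK) mulfK.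
  rewrite conj // mxtrace_mulC mulmxA mulmxV // mul1mx pw.
  by apply: (@trace_maps w (fun=> 1)) => K; rewrite mxE enum_rankK mul1r.
have wH := eigen_maps WG phiW e_neq0 e_orth alpha_ker wW we.
have ztE : zt H = zeta by rewrite /zt we linearZ /= /GRing.scale /= mulfK // (alpha_e_neq0
  e_neq0 e_orth alpha_ker).
rewrite -ztE; apply: (unit_complex_sum _ tr wH) => K wK.
(* Each [zt K] is the eigenvalue of w on e K, hence a root of unity and of modulus 1. *)
have [k k0 kP] := eigenvalue_root_of_unity WG e_neq0.
have := kP w K (zt K) wW (stabilizer_root WG phiW e_neq0 e_orth alpha_ker wW wK).
move=> ztk; rewrite normrX; suff -> : `|zt K| = 1 by rewrite expr1n.
have /eqP : `|zt K| ^+ k = 1 by rewrite -normrX ztk normr1.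
by rewrite pexprn_eq1 // -leqn0 leqNgt k0 => /eqP.
Qed.

End Main.

Theorem theorem5p5 (R : realType) (n : nat) (n_gt0 : (0 < n)%N)
  (W : {fset 'M[Cx R]_n})
  (Wrefl : generated_by_reflections [set` W])
  (Aess : essential (arrangement W))
  (Wfree : acts_freely W (regular_part W))
  (phi : {dot 'cV[Cx R]_n for Num.conj})
  (phiW : forall w, w \in W ->
     forall u v : 'cV[Cx R]_n, phi (w *m u) (w *m v) = phi u v)
  (e : arrangement W -> 'cV[Cx R]_n)
  (e_neq0 : forall H, e H != 0)
  (e_orth : forall (H : arrangement W) (u : 'cV[Cx R]_n),
     u \in val H -> phi u (e H) = 0)
  (alpha : arrangement W -> 'Hom('cV[Cx R]_n, (Cx R)^o))
  (alpha_ker : forall H, lker (alpha H) = val H)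
  (z : regular_part W) :
  exists kappa : nat,
    [/\ is_minimum (kappa_set e) kappa,
        forall h : Cx R, rep_iso z (Rh z alpha (h + kappa%:R)) (Rh z alpha h),
        rep_iso z (Rh z alpha kappa%:R) (fun sigma => R0 W (braid_proj z sigma))
      & forall c : R, 0 < c ->
          rep_iso z (Rh z alpha (Cx_of_real c))
                    (fun sigma => R0 W (braid_proj z sigma)) ->
          kappa%:R <= c].
Proof.
have WG := generated_by_reflections_group Wrefl.
have [kappa kmin] := kappa_exists WG e_neq0.
have periodic := Rh_periodic WG phiW e_neq0 e_orth alpha_ker z kmin.1.
(* The intersection of an empty arrangement would be the whole space, of positive dimension, so
   essentiality provides a hyperplane. *)
have H0 : arrangement W.
  case: (pickP (fun _ : arrangement W => true)) => [H _|noH]; first exact: H.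
  exfalso; move: Aess; rewrite /essential big_pred0 // =>
    /(congr1 (fun U : {vspace 'cV[Cx R]_n} => \dim U)).
  by rewrite dimvf dimv0 /dim /= muln1 => n0; move: n_gt0; rewrite n0.
exists kappa; split => //.
- have [Q Qu QE] := periodic 0; exists Q => // sigma Bs.
  by have := QE sigma Bs; rewrite add0r Rh0.
- exact: (Rh_minimal WG Wfree phiW e_neq0 e_orth alpha_ker H0 kmin).
Qed.
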